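(* Let $C:f=0$ be a 3-syzygy curve of degree $d\geq 3$ in $\mathbb{P}^2$ with exponents $(d_1,d_2,d_3)$ and set $e=d_1+d_2+d_3$. Then the following hold. (i) The minimal free resolution of $N(f)$ as a graded $S$-module has the form $$0\to S(-e)\to\oplus_{j=1}^3S(1-d-d_j)\to\oplus_{j=1}^3S(d_j+2-2d)\to S(e+3-3d),$$ where the leftmost map is the same as the leftmost map in the minimal graded free resolution $$0\to S(-e)\to\oplus_{j=1}^3S(1-d-d_j)\to S^3(1-d)\to S$$ of $M(f)$. In particular, $$\sigma(C)=3(d-1)-(d_1+d_2+d_3).$$ (ii) If $d_1\geq 2$, then the resolution of $S/I_f$ is given by $$0\to\oplus_{j=1}^3S(d_j+2-2d)\to S^3(1-d)\oplus S(e+3-3d)\to S.$$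
   Context: Let $S=\mathbb{C}[x,y,z]$ with its standard grading, and let $C:f=0$ be a reduced curve of degree $d$ in $\mathbb{P}^2$, with $f\in S$ homogeneous of degree $d$. Let $J_f=(f_x,f_y,f_z)$ and $M(f)=S/J_f$. Put $AR(f)=\{(a,b,c)\in S^3: af_x+bf_y+cf_z=0\}$, a graded $S$-module in which $(a,b,c)$ has degree $k$ when $a,b,c\in S_k$. The curve $C$ is an $m$-syzygy curve if a minimal set of homogeneous generators of $AR(f)$ has $m$ elements; the degrees $d_1\leq\dots\leq d_m$ of these generators are the exponents of $C$. Let $I_f$ be the saturation of $J_f$ with respect to $\mathbf{m}=(x,y,z)$ and $N(f)=I_f/J_f$ (the Jacobian module). Set $n(f)_k=\dim N(f)_k$ and $\sigma(C)=\min\{j:n(f)_j\neq 0\}$. In (ii), ''resolution'' means graded free resolution (of the displayed form), with no claim of minimality. *)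

(* Defs.v *)
From HB Require Import structures.
From mathcomp Require Import all_boot all_order all_algebra.
From mathcomp Require Import boolp classical_sets reals.
From mathcomp.real_closed Require Export complex.
From mathcomp.multinomials Require Export mpoly.

Set Implicit Arguments.
Unset Strict Implicit.
Unset Printing Implicit Defensive.

Import GRing.Theory Num.Theory.
Local Open Scope ring_scope.
Local Open Scope quotient_scope.

(* MathComp has quotients of additive groups by decidable subgroups only; the
   quotient of a module by a submodule is built on top of them, membership
   being made boolean by classical logic. *)
Section ModuleQuotient.
Variables (A : nzRingType) (V : lmodType A).

Definition is_submodule (W : V -> Prop) : Prop :=
  [/\ W 0, forall u v, W u -> W v -> W (u + v) & forall a v, W v -> W (a *: v)].

Record submodule := Submodule {
  in_submodule :> V -> Prop;
  submoduleP : is_submodule in_submodule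
}.

Lemma in_submodule0 (W : submodule) : W 0.
Proof. by case: (submoduleP W). Qed.

Lemma in_submoduleD (W : submodule) u v : W u -> W v -> W (u + v).
Proof. by case: (submoduleP W) => _ + _; exact. Qed.

Lemma in_submoduleZ (W : submodule) a v : W v -> W (a *: v).
Proof. by case: (submoduleP W) => _ _; exact. Qed.

Variable W : submodule.

Definition mem_submodule : {pred V} := fun v => `[< W v >].

Lemma mem_submodule_zmod_closed : zmod_closed mem_submodule.
Proof.
split=> [|u v /asboolP Wu /asboolP Wv]; apply/asboolP.
  exact: in_submodule0.
by apply: in_submoduleD => //; rewrite -scaleN1r; apply: in_submoduleZ.
Qed.

HB.instance Definition _ :=
  GRing.isZmodClosed.Build V mem_submodule mem_submodule_zmod_closed.

Definition quot_mod : Type := Quotient.quot mem_submodule.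

HB.instance Definition _ := GRing.Zmodule.on quot_mod.

Definition quot_proj (v : V) : quot_mod := \pi_(Quotient.quot mem_submodule) v.

Definition quot_repr (v : quot_mod) : V :=
  repr (v : Quotient.quot mem_submodule).

Lemma quot_reprK : cancel quot_repr quot_proj.
Proof. exact: reprK. Qed.

Lemma quot_proj_eq u v : quot_proj u = quot_proj v <-> W (u - v).
Proof.
split=> [/eqP|Wuv]; first by rewrite -Quotient.idealrBE => /asboolP.
by apply/eqP; rewrite -Quotient.idealrBE; apply/asboolP.
Qed.

Lemma quot_projD u v : quot_proj (u + v) = quot_proj u + quot_proj v.
Proof. exact: (raddfD (\pi_(Quotient.quot mem_submodule))). Qed.

Definition quot_scale (a : A) (v : quot_mod) : quot_mod :=
  quot_proj (a *: quot_repr v).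

Lemma quot_scale_proj a v : quot_scale a (quot_proj v) = quot_proj (a *: v).
Proof.
apply/quot_proj_eq; rewrite -scalerBr; apply: in_submoduleZ.
by apply/quot_proj_eq; exact: quot_reprK.
Qed.

Let quot_scaleA a b v : quot_scale a (quot_scale b v) = quot_scale (a * b) v.
Proof. by rewrite -[v]quot_reprK !quot_scale_proj scalerA. Qed.

Let quot_scale1 : left_id 1 quot_scale.
Proof. by move=> v; rewrite -[v]quot_reprK quot_scale_proj scale1r. Qed.

Let quot_scaleDr : right_distributive quot_scale +%R.
Proof.
move=> a u v; rewrite -[u]quot_reprK -[v]quot_reprK -quot_projD.
by rewrite !quot_scale_proj scalerDr quot_projD.
Qed.

Let quot_scaleDl v : {morph quot_scale^~ v : a b / a + b}.
Proof.
by move=> a b; rewrite -[v]quot_reprK !quot_scale_proj scalerDl quot_projD.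
Qed.

HB.instance Definition _ := GRing.Zmodule_isLmodule.Build A quot_mod
  quot_scaleA quot_scale1 quot_scaleDr quot_scaleDl.

Lemma quot_proj_is_linear : linear quot_proj.
Proof. by move=> a u v; rewrite quot_projD -quot_scale_proj. Qed.

HB.instance Definition _ :=
  GRing.isLinear.Build A V quot_mod _ quot_proj quot_proj_is_linear.

End ModuleQuotient.

Section GradedResolutions.
Variable K : fieldType.
Local Notation S := {mpoly K[3]}.

(* p \in S_k, where S_k = 0 for k < 0. *)
Definition in_degree (k : int) (p : S) : bool :=
  if k is Posz n then p \is n.-homog else p == 0.

Definition irrelevant (p : S) : Prop :=
  exists a : 'I_3 -> S, p = \sum_i a i * 'X_i.

(* The direct sum S(a_0) + ... + S(a_(n-1)), where a : seq int, is 'rV[S]_n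
   with the following grading: S(a)_k = S_(k + a). *)
Definition in_twisted_degree (a : seq int) (k : int) (v : 'rV[S]_(size a)) :
  bool := [forall j : 'I_(size a), in_degree (k + a`_j) (v 0 j)].

Definition rk (t : seq (seq int)) (i : nat) : nat := size (nth [::] t i).

(* Maps ... -> F_1 -> F_0 -> V, where F_i is free with twists the i-th entry of
   t (so F_i = 0 when size t <= i). Matrices act on row vectors on the right. *)
Record free_sequence (t : seq (seq int)) (V : lmodType S) := FreeSequence {
  aug : {linear 'rV[S]_(rk t 0) -> V};
  differential : forall i, 'M[S]_(rk t i.+1, rk t i)
}.

(* r is a graded free resolution of the graded submodule W of the module V,
   whose homogeneous component of degree k is Vdeg k. *)
Definition graded_resolution (V : lmodType S) (Vdeg : int -> V -> Prop)
    (W : V -> Prop) (t : seq (seq int)) (r : free_sequence t V) : Prop :=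
  [/\ forall k v, in_twisted_degree k v -> Vdeg k (aug r v),
      forall i k (v : 'rV[S]_(rk t i.+1)),
        in_twisted_degree k v -> in_twisted_degree k (v *m differential r i),
      forall w, W w <-> exists v, w = aug r v,
      forall v, aug r v = 0 <-> exists u, v = u *m differential r 0
    & forall i (v : 'rV[S]_(rk t i.+1)),
        v *m differential r i = 0 <-> exists u, v = u *m differential r i.+1].

Definition minimal_graded_resolution (V : lmodType S)
    (Vdeg : int -> V -> Prop) (W : V -> Prop) (t : seq (seq int))
    (r : free_sequence t V) : Prop :=
  graded_resolution Vdeg W r /\ forall i p q, irrelevant (differential r i p q).

Definition is_dim (V : lmodType S) (W : V -> Prop) (n : nat) : Prop :=
  exists b : 'I_n -> V, (forall i, W (b i)) /\
    forall v, W v -> exists! c : 'rV[K]_n, v = \sum_i (c 0 i)%:MP *: b i.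

(* The dimension over K of a K-subspace W of V, 0 when it is infinite. *)
Definition Kdim (V : lmodType S) (W : V -> Prop) : nat :=
  xget 0%N [set n | is_dim W n]%classic.

End GradedResolutions.

Section JacobianModule.
Variable K : fieldType.
Local Notation S := {mpoly K[3]}.

(* S/(f) has no nonzero nilpotent element; the zero polynomial, for
   which this also holds, does not define a curve. *)
Definition reduced (f : S) : Prop :=
  f != 0 /\ forall (g : S) (n : nat),
    (exists q, g ^+ n = q * f) -> exists q, g = q * f.

(* The degree-k part of AR f consists of the r with entries in S_k, without
   the shift by d - 1. *)
Definition AR (f : S) (r : 'rV[S]_3) : Prop :=
  \sum_i r 0 i * f^`M(i) = 0.

(* rho is a minimal family of homogeneous generators of AR f, of degrees ds. *)
Definition minimal_syzygies (f : S) (ds : seq nat)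
    (rho : 'I_(size ds) -> 'rV[S]_3) : Prop :=
  [/\ forall i, AR f (rho i),
      forall i j, rho i 0 j \is (nth 0%N ds i).-homog,
      forall r, AR f r ->
        exists a : 'I_(size ds) -> S, r = \sum_i a i *: rho i
    & forall i, ~ exists a : 'I_(size ds) -> S,
        rho i = \sum_(j | j != i) a j *: rho j].

(* The curve f = 0 is a (size ds)-syzygy curve with exponents ds. *)
Definition syzygy_curve (f : S) (ds : seq nat) : Prop :=
  sorted leq ds /\ exists rho, @minimal_syzygies f ds rho.

(* Ideals of S are submodules of the regular module S^o. *)
Definition in_jacobian (f : S) (g : S^o) : Prop :=
  exists a : 'I_3 -> S, g = \sum_i a i * f^`M(i).

Lemma in_jacobian_submodule f : is_submodule (in_jacobian f).
Proof.
split=> [|g h [a gE] [b hE]|c g [a gE]].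
- by exists (fun=> 0); rewrite big1 // => i _; rewrite mul0r.
- exists (fun i => a i + b i); under eq_bigr => i _ do rewrite mulrDl.
  by rewrite big_split /= -gE -hE.
- exists (fun i => c * a i); under eq_bigr => i _ do rewrite -mulrA.
  by rewrite -mulr_sumr -gE.
Qed.

Definition jacobian_ideal (f : S) : submodule S^o :=
  Submodule (in_jacobian_submodule f).

(* g lies in (I : m^n) for some n. *)
Definition in_saturation (I : submodule S^o) (g : S^o) : Prop :=
  exists n, forall u : 'I_n -> S,
    (forall i, irrelevant (u i)) -> I ((\prod_i u i) * g).

Lemma in_saturation_submodule I : is_submodule (in_saturation I).
Proof.
split=> [|g h [m gI] [n hI]|c g [n gI]].
- by exists 0%N => u _; rewrite mulr0; apply: in_submodule0.
- exists (m + n)%N => u um; rewrite big_split_ord mulrDr; apply: in_submoduleD.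
    rewrite [X in X * g]mulrC -mulrA.
    by apply/in_submoduleZ/gI => i; exact: um.
  by rewrite -mulrA; apply/in_submoduleZ/hI => i; exact: um.
- by exists n => u um; rewrite mulrCA; exact/in_submoduleZ/gI.
Qed.

Definition saturation (I : submodule S^o) : submodule S^o :=
  Submodule (in_saturation_submodule I).

(* The degree-k part of S/I. *)
Definition quot_degree (I : submodule S^o) (k : int) (v : quot_mod I) : Prop :=
  exists2 g : S, in_degree k g & v = quot_proj I g.

Arguments quot_degree I k v : clear implicits.

Section JacobianAlgebra.
Variable f : S.

Definition milnor_algebra : lmodType S := quot_mod (jacobian_ideal f).

(* N(f) = I_f / J_f, as a submodule of M(f) = S / J_f. *)
Definition jacobian_module (v : milnor_algebra) : Prop :=
  exists2 g, saturation (jacobian_ideal f) g & v = quot_proj _ g.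

(* n(f)_k *)
Definition defect (k : int) : nat :=
  Kdim (fun v => jacobian_module v /\ quot_degree (jacobian_ideal f) k v).

(* s = sigma(C) *)
Definition is_sigma (s : int) : Prop :=
  defect s != 0%N /\ forall j, defect j != 0%N -> s <= j.

End JacobianAlgebra.

End JacobianModule.

Arguments quot_degree {K} I k v.
Arguments jacobian_module {K} f v.

(* Main.v *)
From HB Require Import structures.
Require Import Defs.
From mathcomp Require Import all_boot all_order all_algebra reals.
From mathcomp Require Import boolp classical_sets ring zify.

Set Implicit Arguments.
Unset Strict Implicit.
Unset Printing Implicit Defensive.

Import GRing.Theory Num.Theory.
Local Open Scope ring_scope.

(* Let g be generators of J_f, A their syzygy matrix and h a generator of the
   left kernel of A. Because f is reduced, J_f has depth at least 2, and hence
   adj A = g^T h once g is suitably scaled. The Koszul syzygies of g, which are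
   the rows of the cross product matrix X_g, are combinations of the rows of A:
   X_g = B A. Passing to adjugates gives
   g = h adj B, and so w h = g B for w = det B: thus (h) annihilates the class
   of w modulo J_f, and skew-symmetry of X_g shows that it is the whole
   annihilator. Moreover A = X_h B^T.

   The vanishing of Tor_3 modulo two linear forms shows that (h) contains a
   power of the irrelevant ideal, so h is a regular sequence. Comparing the
   Koszul complexes of (x^N, y^N, z^N) and of h with the resolution of S/J_f
   shows that I_f = J_f + (w). Therefore N(f) = S w = S/(h) up to a twist, it
   is resolved by the Koszul complex of h, and the relations among g and w are
   generated by the rows of (B^T | -h^T). *)

(** Part (i) quantifies over all minimal resolutions of [M(f)], so the argument uses only exactness
    of [h], [A], [g^T]: [g] is some row generating the Jacobian ideal, and [h] is determined by [A]
    only up to a unit, which the scaling of [g] absorbs. [B] compares the Koszul complex of [g] with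
    the resolution, and [w] is a transition determinant in the sense of linkage. The delicate point
    is that [(h)] contains a power of the irrelevant ideal. Instead of a zero over an algebraically
    closed field, the proof takes the tautological zero in [L = K[x,y,z]/(h, x_i - 1)], a ring that
    may have zero divisors. Exactness must then be carried along [K -> L], which works because
    modules over a field are flat. The saturation comes from two descents: along powers of the
    variables, which shows that [h] multiplies [I_f] into [J_f], then along [h], where the
    obstruction is the coefficient of [w]. *)

Definition o0 : 'I_3 := ord0.
Definition o1 : 'I_3 := lift ord0 ord0.
Definition o2 : 'I_3 := lift ord0 (lift ord0 ord0).

Lemma sum3 (V : nmodType) (F : 'I_3 -> V) : \sum_i F i = F o0 + F o1 + F o2.
Proof. by rewrite !big_ord_recl big_ord0 addr0 addrA. Qed.

Lemma ord3_ind (P : 'I_3 -> Prop) : P o0 -> P o1 -> P o2 -> forall i, P i.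
Proof.
move=> P0 P1 P2 [[|[|[|i]]] li] //.
- by have -> : Ordinal li = o0 by apply: val_inj.
- by have -> : Ordinal li = o1 by apply: val_inj.
- by have -> : Ordinal li = o2 by apply: val_inj.
Qed.

(** * Adjugates and cross products of size three *)

Section ThreeByThree.
Variable S : comNzRingType.
Implicit Types (M N : 'M[S]_3) (a b : 'rV[S]_3).

Definition table (l : seq (seq S)) : 'M[S]_3 :=
  \matrix_(i, j) nth 0 (nth [::] l i) j.

(* [c *m skew3 a] is the cross product of [c] and [a], so [skew3 a] is also the
   middle differential of the Koszul complex of [a]. *)
Definition skew3 a : 'M[S]_3 :=
  table [:: [:: 0; - a 0 o2; a 0 o1];
            [:: a 0 o2; 0; - a 0 o0];
            [:: - a 0 o1; a 0 o0; 0]].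

Lemma adj3E M : \adj M = table
  [:: [:: M o1 o1 * M o2 o2 - M o1 o2 * M o2 o1;
          M o0 o2 * M o2 o1 - M o0 o1 * M o2 o2;
          M o0 o1 * M o1 o2 - M o0 o2 * M o1 o1];
      [:: M o1 o2 * M o2 o0 - M o1 o0 * M o2 o2;
          M o0 o0 * M o2 o2 - M o0 o2 * M o2 o0;
          M o0 o2 * M o1 o0 - M o0 o0 * M o1 o2];
      [:: M o1 o0 * M o2 o1 - M o1 o1 * M o2 o0;
          M o0 o1 * M o2 o0 - M o0 o0 * M o2 o1;
          M o0 o0 * M o1 o1 - M o0 o1 * M o1 o0]].
Proof.
(* Indexing by natural numbers lets the indices produced by the cofactors compute. *)
pose m (p q : nat) := M (inord p) (inord q).
have E (i j : 'I_3) : M i j = m i j by rewrite /m !inord_val.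
apply/matrixP => i j; rewrite !mxE /cofactor (expand_det_row _ ord0).
rewrite !big_ord_recl big_ord0 /cofactor !det_mx11 !mxE !E /=.
by elim/ord3_ind: i; elim/ord3_ind: j; rewrite /= /bump /=; ring.
Qed.

Lemma det3E M : \det M =
  M o0 o0 * \adj M o0 o0 + M o0 o1 * \adj M o1 o0 + M o0 o2 * \adj M o2 o0.
Proof. by rewrite (expand_det_row _ o0) sum3 !mxE. Qed.

Ltac entries3 :=
  let i := fresh in let j := fresh in
  apply/matrixP => i j; rewrite ?adj3E !mxE ?sum3;
  (try elim/ord3_ind: i); (try elim/ord3_ind: j);
  rewrite /= ?mxE ?sum3 /= ?mxE ?sum3 /= ?mxE.

Lemma adj3M M N : \adj (M *m N) = \adj N *m \adj M.
Proof. by rewrite !adj3E; entries3; ring. Qed.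

Lemma skewK a : skew3 a *m a^T = 0.
Proof. by entries3; rewrite ?ord1; ring. Qed.

Lemma tr_skew a : (skew3 a)^T = - skew3 a.
Proof. by entries3; ring. Qed.

Lemma mul_skew a : a *m skew3 a = 0.
Proof.
by apply: trmx_inj; rewrite trmx_mul tr_skew mulNmx skewK oppr0 trmx0.
Qed.

Lemma adj_skew a : \adj (skew3 a) = a^T *m a.
Proof. by rewrite adj3E; entries3; rewrite big_ord1 !mxE /=; ring. Qed.

(** Congruence on skew forms is the second exterior power, which the cross product identifies with
    the action of the cofactor matrix on vectors. *)
Lemma skew_congr M a : M^T *m skew3 a *m M = skew3 (a *m (\adj M)^T).
Proof. by rewrite adj3E; entries3; ring. Qed.

Lemma skew_skew a b : skew3 a *m skew3 b = b^T *m a - (b *m a^T) 0 0 *: 1%:M.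
Proof. by entries3; rewrite ?big_ord1 ?mxE; ring. Qed.

Lemma skewZ (c : S) a : skew3 (c *: a) = c *: skew3 a.
Proof. by entries3; ring. Qed.

Lemma skew_inj : injective skew3.
Proof.
move=> a b /matrixP ab; apply/rowP; elim/ord3_ind.
- by move: (ab o2 o1); rewrite !mxE.
- by move: (ab o0 o2); rewrite !mxE.
- by move: (ab o1 o0); rewrite !mxE.
Qed.

Lemma antisym_skew M : exists a, M - M^T = skew3 a.
Proof.
exists (\row_j [:: M o2 o1 - M o1 o2; M o0 o2 - M o2 o0; M o1 o0 - M o0 o1]`_j).
by entries3; ring.
Qed.

End ThreeByThree.

(** * Exactness and Koszul complexes *)

Section Exactness.
Variable S : comNzRingType.

Definition exact_mx (l m n : nat) (D : 'M[S]_(l, m)) (E : 'M[S]_(m, n)) :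
    Prop :=
  forall v : 'rV_m, v *m E = 0 <-> exists u, v = u *m D.

(** Over a domain, [a != 0] is injectivity of the leftmost Koszul map. *)
Definition koszul_exact (a : 'rV[S]_3) : Prop :=
  [/\ a != 0, exact_mx (skew3 a) a^T & exact_mx a (skew3 a)].

Lemma mulmx_exists (k m n : nat) (C : 'M[S]_(k, n)) (D : 'M[S]_(m, n)) :
  (forall i, exists u, row i C = u *m D) -> exists U, C = U *m D.
Proof.
move=> /fin_all_exists[u uP]; exists (\matrix_i u i).
by apply/row_matrixP => i; rewrite row_mul rowK.
Qed.

Lemma exact_mxM (l m n : nat) (D : 'M[S]_(l, m)) (E : 'M[S]_(m, n)) :
  exact_mx D E -> D *m E = 0.
Proof.
move=> DE; apply/row_matrixP => i; rewrite row_mul row0; apply/DE.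
by exists (delta_mx 0 i); rewrite rowE.
Qed.

Lemma exact_mx_factor (k l m n : nat) (D : 'M[S]_(l, m)) (E : 'M[S]_(m, n))
    (C : 'M[S]_(k, m)) :
  exact_mx D E -> C *m E = 0 -> exists U, C = U *m D.
Proof.
move=> DE CE; apply: mulmx_exists => i; apply/DE.
by rewrite -row_mul CE row0.
Qed.

(** The Koszul complex is self-dual, as [skew3 a] is skew: exactness on rows gives exactness on
    columns. *)
Lemma koszul_skewl (n : nat) (a : 'rV[S]_3) (D : 'M[S]_(3, n)) :
  exact_mx (skew3 a) a^T -> a *m D = 0 -> exists E, D = skew3 a *m E.
Proof.
move=> aP /(congr1 trmx); rewrite trmx_mul trmx0 => /(exact_mx_factor aP)[U DU].
by exists (- U^T); rewrite -[D]trmxK DU trmx_mul tr_skew mulNmx mulmxN.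
Qed.

Lemma koszul_trl (n : nat) (a : 'rV[S]_3) (D : 'M[S]_(3, n)) :
  exact_mx a (skew3 a) -> skew3 a *m D = 0 -> exists r : 'rV_n, D = a^T *m r.
Proof.
move=> aP /(congr1 trmx); rewrite trmx_mul trmx0 tr_skew mulmxN => /eqP.
rewrite oppr_eq0 => /eqP/(exact_mx_factor aP)[U DU].
by exists U^T; rewrite -[D]trmxK DU trmx_mul.
Qed.

End Exactness.

Section DomainExactness.
Variable S : idomainType.

Lemma scalemx_eq0 (m n : nat) (a : S) (M : 'M[S]_(m, n)) :
  (a *: M == 0) = (a == 0) || (M == 0).
Proof.
apply/eqP/orP => [aM|[/eqP->|/eqP->]]; rewrite ?scale0r ?scaler0 //.
have [_|a0] := boolP (a == 0); [by left | right].
apply/eqP/matrixP => i j; move/matrixP/(_ i j)/eqP: aM.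
by rewrite !mxE mulf_eq0 (negPf a0) => /eqP.
Qed.

Lemma mulmx_col_inj (m n : nat) (a : 'cV[S]_m) : a != 0 ->
  injective (fun p : 'rV[S]_n => a *m p).
Proof.
move=> /cV0Pn[i ai0] p q /matrixP pq; apply/rowP => j.
by move: (pq i j); rewrite !mxE !big_ord1; apply: mulfI.
Qed.

Lemma mulmx_row_inj (m n : nat) (h : 'rV[S]_n) : h != 0 ->
  injective (fun p : 'cV[S]_m => p *m h).
Proof.
move=> h0 p q /(congr1 trmx); rewrite !trmx_mul => pq.
by apply/trmx_inj/(@mulmx_col_inj _ _ h^T); rewrite ?trmx_eq0.
Qed.

(* The total complex of the Koszul complex of [a] tensored with [D3, D2, D1]:
   the obstruction to descending [p] along [a] is the class of [t] modulo [a],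
   where [a *m D = t *m D3]. *)
Lemma koszul_descent (n0 n1 n2 n3 : nat) (a : 'rV[S]_3) (D1 : 'M[S]_(n1, n0))
    (D2 : 'M[S]_(n2, n1)) (D3 : 'M[S]_(n3, n2)) (p : 'rV[S]_n0)
    (C : 'M[S]_(3, n1)) (D : 'M[S]_(3, n2)) (t : 'M[S]_(3, n3)) :
  koszul_exact a -> D2 *m D1 = 0 -> D3 *m D2 = 0 ->
  a^T *m p = C *m D1 -> skew3 a *m C = D *m D2 -> a *m D = a *m t *m D3 ->
  exists r, p = r *m D1.
Proof.
case=> a0 a1 a2 D21 D32 Cp DC aD.
have [E DE] : exists E, D - t *m D3 = skew3 a *m E.
  by apply: koszul_skewl a1 _; rewrite mulmxBr mulmxA aD subrr.
have [r Cr] : exists r : 'rV_n1, C - E *m D2 = a^T *m r.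
  apply: koszul_trl a2 _; rewrite mulmxBr DC mulmxA -DE mulmxBl -(mulmxA t) D32.
  by rewrite mulmx0 subr0 subrr.
exists r; apply: (@mulmx_col_inj _ _ a^T); first by rewrite trmx_eq0.
by rewrite mulmxA -Cr mulmxBl -mulmxA D21 mulmx0 subr0.
Qed.

Lemma skew_eq0_tr (a b : 'rV[S]_3) : a *m skew3 b = 0 -> a^T *m b = b^T *m a.
Proof.
move=> /rowP ab; apply/matrixP; do 2 elim/ord3_ind;
  move: (ab o0) (ab o1) (ab o2); rewrite !mxE !sum3 !big_ord1 !mxE /= => e0 e1 e2.
all: try by rewrite mulrC.
all: apply/eqP; rewrite -subr_eq0; apply/eqP.
all: try by rewrite -[RHS]e0; ring.
all: try by rewrite -[RHS]e1; ring.
all: try by rewrite -[RHS]e2; ring.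
all: apply/eqP; rewrite -oppr_eq0; apply/eqP.
all: try by rewrite -[RHS]e0; ring.
all: try by rewrite -[RHS]e1; ring.
all: by rewrite -[RHS]e2; ring.
Qed.

Lemma adj_rank1 (u v : 'rV[S]_3) : \adj (u^T *m v) = 0.
Proof.
rewrite adj3E; apply/matrixP => i j; rewrite !mxE !big_ord1 !mxE.
by elim/ord3_ind: i; elim/ord3_ind: j; rewrite /=; ring.
Qed.

Lemma skew_mul_skew (a b : 'rV[S]_3) :
  skew3 (a *m skew3 b) = b^T *m a - a^T *m b.
Proof.
apply/matrixP => i j; rewrite !mxE !sum3 !big_ord1 !mxE.
by elim/ord3_ind: i; elim/ord3_ind: j; rewrite /=; ring.
Qed.

Lemma tr_eq_skew0 (a b : 'rV[S]_3) : a^T *m b = b^T *m a -> a *m skew3 b = 0.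
Proof.
move=> /matrixP ab; have E i j : a 0 i * b 0 j = b 0 i * a 0 j.
  by move: (ab i j); rewrite !mxE !big_ord1 !mxE.
apply/rowP; elim/ord3_ind; rewrite mxE sum3 !mxE /=.
- by rewrite (E o1 o2); ring.
- by rewrite (E o2 o0); ring.
- by rewrite (E o0 o1); ring.
Qed.

End DomainExactness.

(** * The left kernel of the syzygy matrix *)

Section LeftKernel.
Variables (S : idomainType) (A : 'M[S]_3) (g : 'rV[S]_3).
Hypotheses (syzA : exact_mx A g^T) (depth2 : exact_mx g (skew3 g)).

Lemma depth2_neq0 : g != 0.
Proof.
apply/eqP => g0; have /depth2[u] : (delta_mx 0 o0 : 'rV_3) *m skew3 g = 0.
  rewrite g0; apply/rowP; elim/ord3_ind; rewrite !mxE sum3 !mxE /=; ring.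
by rewrite g0 mulmx0 => /rowP/(_ o0); rewrite !mxE /= => /eqP; rewrite oner_eq0.
Qed.

(** Since [skew3 g] kills [\adj A], depth two makes its columns multiples of [g^T]; the multipliers
    form [r]. A vector killed by [A] is parallel to [r], for otherwise [A] would have rank at most
    one and [\adj A] would vanish. *)
Lemma left_kernel : exists B r,
  [/\ skew3 g = B *m A, \adj A = g^T *m r, r != 0 & exact_mx r A].
Proof.
have g0 := depth2_neq0.
have [B gB] : exists B, skew3 g = B *m A.
  by apply: exact_mx_factor syzA _; apply: skewK.
have detA : \det A = 0.
  have := mul_adj_mx A => /(congr1 (mulmxr g^T)) /=.
  rewrite -mulmxA (exact_mxM syzA) mulmx0 mul_scalar_mx => /esym/eqP.
  by rewrite scalemx_eq0 trmx_eq0 (negPf g0) orbF => /eqP.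
have [r adjr] : exists r : 'rV_3, \adj A = g^T *m r.
  apply: koszul_trl depth2 _.
  by rewrite gB -mulmxA mul_mx_adj detA raddf0 mulmx0.
have rA : r *m A = 0.
  apply: (@mulmx_col_inj _ _ _ g^T); first by rewrite trmx_eq0.
  by rewrite mulmxA -adjr mul_adj_mx detA mulmx0 raddf0.
have gE : g = r *m \adj B.
  apply: (@mulmx_col_inj _ _ _ g^T); first by rewrite trmx_eq0.
  by rewrite -adj_skew gB adj3M adjr -mulmxA.
have r0 : r != 0 by apply: contraNneq g0 => r0; rewrite gE r0 mul0mx.
exists B, r; split=> // c; split; last by case=> u ->; rewrite -mulmxA rA mulmx0.
move=> cA.
have cr : c *m skew3 r = 0.
  (* The columns of [A] are orthogonal to [c] and [r], hence parallel to their cross product [n], so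
     [n 0 i *: A] has rank at most one. *)
  apply/eqP/contraT => /rV0Pn[i ni]; set n := c *m skew3 r in ni.
  have nA : skew3 n *m A = 0.
    rewrite /n skew_mul_skew mulmxBl -!mulmxA cA rA !mulmx0 subr0 //.
  have /eqP : (n 0 i) ^+ 2 *: \adj A = 0.
    rewrite -adjZ; have -> : n 0 i *: A = n^T *m row i A.
      apply/matrixP => k l; rewrite !mxE big_ord1 !mxE; apply/esym.
      have /skew_eq0_tr/matrixP/(_ k i) : row l A^T *m skew3 n = 0.
        rewrite -row_mul -[skew3 n]trmxK -trmx_mul tr_skew mulNmx nA.
        by rewrite oppr0 trmx0 row0.
      by rewrite !mxE !big_ord1 !mxE mulrC => ->.
    exact: adj_rank1.
  rewrite scalemx_eq0 expf_eq0 /= (negPf ni) adjr => /eqP gr0.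
  case/eqP: r0; apply: (@mulmx_col_inj _ _ _ g^T); first by rewrite trmx_eq0.
  by rewrite mulmx0.
have crT := skew_eq0_tr cr.
(* As [c] is parallel to [r], its image under [\adj B] is parallel to [g]; the ratio that depth two
   supplies there is also the ratio of [c] to [r]. *)
have [l cl] : exists l, c *m \adj B = l *m g.
  apply/depth2/tr_eq_skew0; rewrite {1}gE trmx_mul -mulmxA (mulmxA c^T) crT.
  by rewrite mulmxA mulmxA -trmx_mul -gE -mulmxA.
exists l^T; apply: trmx_inj; apply: (mulmx_row_inj g0) => /=.
by rewrite trmx_mul trmxK -mulmxA -cl {1}gE mulmxA crT mulmxA.
Qed.

(** Two generators of the same free rank-one kernel differ by a unit; as [h] is prescribed, the unit
    is moved to [g]. *)
Lemma left_kernel_normalize (h : 'rV[S]_3) : exact_mx h A ->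
  exists l B, [/\ l \is a GRing.unit, skew3 (l *: g) = B *m A
    & \adj A = (l *: g)^T *m h].
Proof.
move=> kerA; have [B [r [gB adjA r0 kerA']]] := left_kernel.
have [u ru] : exists u, r = u *m h by apply/kerA/kerA'; exists 1; rewrite mul1mx.
have [v hv] : exists v, h = v *m r by apply/kerA'/kerA; exists 1; rewrite mul1mx.
have uE : u *m h = u 0 0 *: h by rewrite {1}[u]mx11_scalar mul_scalar_mx.
have vE : v *m r = v 0 0 *: r by rewrite {1}[v]mx11_scalar mul_scalar_mx.
exists (u 0 0), (u 0 0 *: B); split.
- have /rV0Pn[k rk] := r0; apply/unitrP; exists (v 0 0).
  suff uv : u 0 0 * v 0 0 = 1 by rewrite mulrC uv.
  by apply: (mulIf rk); rewrite mul1r {2}ru uE hv vE !mxE mulrA.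
- by rewrite skewZ gB scalemxAl.
- by rewrite adjA ru uE [(_ *: g)^T]linearZ /= -scalemxAl scalemxAr.
Qed.
End LeftKernel.

(** * The annihilator of w and the saturation *)

Section Socle.
Variables (S : idomainType) (A B : 'M[S]_3) (g h : 'rV[S]_3).
Hypotheses (syzA : exact_mx A g^T) (kerA : exact_mx h A) (h0 : h != 0).
Hypotheses (g0 : g != 0) (gB : skew3 g = B *m A) (adjA : \adj A = g^T *m h).
Hypothesis two_unit : 2 \is a @GRing.unit S.
Local Notation w := (\det B).

Lemma transition_adj : g = h *m \adj B.
Proof.
apply: (@mulmx_col_inj _ _ _ g^T); first by rewrite trmx_eq0.
by rewrite -adj_skew gB adj3M adjA -mulmxA.
Qed.

Lemma transition_det : w *: h = g *m B.
Proof. by rewrite transition_adj -mulmxA mul_adj_mx mul_mx_scalar. Qed.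

(* [s *: skew3 g = A^T *m Q *m A] for some [Q]; the left-hand side being skew,
   [Q] may be replaced by its skew part. *)
Lemma colon_det (s : S) (c : 'rV_3) :
  (s * w)%:M = c *m g^T -> exists u, s%:M = u *m h^T.
Proof.
move=> sw.
(* [g] kills this matrix from the left, because [g *m B = w *: h] and [g *m c^T] is [s * w]. *)
have [Q QA] : exists Q, (s *: B - c^T *m h)^T = Q *m A.
  apply: exact_mx_factor syzA _; apply: trmx_inj.
  rewrite trmx_mul !trmxK mulmxBr -scalemxAr -transition_det mulmxA.
  rewrite -[g *m c^T]trmxK trmx_mul trmxK -sw tr_scalar_mx mul_scalar_mx.
  by rewrite scalerA subrr trmx0.
have sX : s *: skew3 g = A^T *m Q^T *m A.
  rewrite -trmx_mul -QA trmxK mulmxBl -scalemxAl -gB -mulmxA.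
  by rewrite (exact_mxM kerA) mulmx0 subr0.
have [y yQ] := antisym_skew Q^T.
(* Subtracting the transpose doubles the skew side, whence the 2; the other side becomes
   [A^T *m skew3 y *m A], the cross product matrix of [y *m (\adj A)^T]. *)
have s2 : (2 * s) *: g = y *m h^T *m g.
  apply: skew_inj; rewrite -mulmxA -[h^T *m g]trmxK trmx_mul trmxK -adjA.
  rewrite -skew_congr -yQ mulmxBr mulmxBl -sX trmxK skewZ mulr_natl mulr2n.
  rewrite scalerDl; congr (_ + _); move/(congr1 trmx): sX.
  rewrite linearZ /= tr_skew scalerN !trmx_mul !trmxK mulmxA => <-.
  by rewrite opprK.
exists (2^-1 *: y); apply: (mulmx_row_inj g0) => /=.
by rewrite -scalemxAl -scalemxAl -s2 scalerA mulKr // mul_scalar_mx.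
Qed.

Hypothesis h_proper : ~ exists u, 1%:M = u *m h^T.

(** Were [w] zero, [1 * w] would lie in [(g)], and [colon_det] would put 1 in [(h)]. *)
Lemma det_transition_neq0 : w != 0.
Proof.
apply/eqP => w0; apply/h_proper/(@colon_det _ 0).
by rewrite w0 mulr0 raddf0 mul0mx.
Qed.

(** Both sides become [skew3 g] after multiplication by [B] on the left, the second by [skew_congr];
    [B] cancels as [w] is nonzero. *)
Lemma syzygies_koszul : A = skew3 h *m B^T.
Proof.
have BX : B *m (skew3 h *m B^T) = B *m A.
  have := skew_congr B^T h; rewrite trmxK -trmx_adj trmxK -transition_adj.
  by rewrite -gB mulmxA.
have : w *: A = w *: (skew3 h *m B^T).
  by rewrite -!mul_scalar_mx -mul_adj_mx -!mulmxA BX.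
move/eqP; rewrite -subr_eq0 -scalerBr scalemx_eq0 (negPf det_transition_neq0).
by rewrite subr_eq0 => /eqP.
Qed.

(** Depth sensitivity of the Koszul complex: a cycle [c] satisfies [h^T *m c = skew3 c *m skew3 h],
    so [(h)], and with it [(a)], kills its class; descent along the regular sequence [a] then makes
    [c] a boundary. *)
Lemma koszul_exact_kernel (a : 'rV_3) (T : 'M_3) :
  koszul_exact a -> a = h *m T -> koszul_exact h.
Proof.
move=> aK aT; split=> //.
  move=> c; split; last by case=> u ->; rewrite -mulmxA skewK mulmx0.
  move=> ch; have hc : h^T *m c = skew3 c *m skew3 h.
    by rewrite skew_skew -[h *m c^T]trmxK trmx_mul trmxK ch !mxE scale0r subr0.
  have Cp : a^T *m c = T^T *m skew3 c *m skew3 h.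
    by rewrite aT trmx_mul -!mulmxA hc.
  (* Such a [v] is parallel to [h], so [v *m A] vanishes with [h *m A], and [kerA] applies. *)
  have kerXh : forall v : 'rV_3, v *m skew3 h = 0 -> exists u, v = u *m h.
    move=> v vh; apply/kerA; apply: (@mulmx_col_inj _ _ _ h^T).
      by rewrite trmx_eq0.
    rewrite mulmx0 mulmxA -skew_eq0_tr // -mulmxA (exact_mxM kerA).
    by rewrite mulmx0.
  have [D DC] : exists D, skew3 a *m (T^T *m skew3 c) = D *m h.
    apply: mulmx_exists => i; apply: kerXh.
    by rewrite -row_mul -mulmxA -Cp mulmxA skewK mul0mx row0.
  have aD : a *m D = 0.
    apply: (mulmx_row_inj h0); rewrite mul0mx -mulmxA -DC mulmxA mul_skew.
    by rewrite mul0mx.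
  apply: (@koszul_descent _ _ _ _ 0 a (skew3 h) h 0 c _ D 0 aK _ _ Cp DC).
  - exact: mul_skew.
  - by rewrite mul0mx.
  - by rewrite aD mulmx0.
move=> v; split; last by case=> u ->; rewrite -mulmxA mul_skew mulmx0.
move=> vh; apply/kerA; apply: (@mulmx_col_inj _ _ _ h^T).
  by rewrite trmx_eq0.
by rewrite mulmx0 mulmxA -skew_eq0_tr // -mulmxA (exact_mxM kerA) mulmx0.
Qed.

(** The obstruction to descending [p] along [a] is the [t] with [a *m D = t *m h]. Multiplied by
    [h 0 i] it becomes the entry [i] of [a *m D], which lies in [(a)]. *)
Lemma kernel_annihilates (a : 'rV_3) (p : S) (C : 'M_3) : koszul_exact a ->
  a^T *m p%:M = C *m g^T -> exists C', h^T *m p%:M = C' *m g^T.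
Proof.
move=> aK pC; apply: mulmx_exists => i.
have [D DA] : exists D, skew3 a *m C = D *m A.
  by apply: exact_mx_factor syzA _; rewrite -mulmxA -pC mulmxA skewK mul0mx.
have [t tD] : exists t, a *m D = t *m h.
  apply: exact_mx_factor kerA _.
  by rewrite -mulmxA -DA mulmxA mul_skew mul0mx.
apply: (@koszul_descent _ _ _ _ _ a g^T A h _ (h 0 i *: C) (h 0 i *: D)
  (col i D) aK).
- exact: exact_mxM.
- exact: exact_mxM.
- rewrite -scalemxAl -pC scalemxAr; congr (_ *m _).
  by apply/rowP => j; rewrite !mxE !big_ord1 !mxE mulrnAr.
- by rewrite -scalemxAl -scalemxAr DA.
- have hi : h *m delta_mx i 0 = (h 0 i)%:M.
    by rewrite -colE; apply/rowP => j; rewrite !ord1 !mxE eqxx mulr1n.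
  rewrite -scalemxAr tD colE mulmxA tD -(mulmxA t) hi mul_mx_scalar.
  by rewrite -scalemxAl.
Qed.

(** Along [h], the element [w] lifts through [B^T] and, by [syzygies_koszul], the identity matrix:
    its obstruction is 1. Subtracting [t 0 0] times these data removes the obstruction of [p]. *)
Lemma socle_generated (p : S) (C : 'M_3) : koszul_exact h ->
  h^T *m p%:M = C *m g^T -> exists s c, (p - s * w)%:M = c *m g^T.
Proof.
move=> hK pC.
have [D DA] : exists D, skew3 h *m C = D *m A.
  by apply: exact_mx_factor syzA _; rewrite -mulmxA -pC mulmxA skewK mul0mx.
have [t tD] : exists t, h *m D = t *m h.
  apply: exact_mx_factor kerA _.
  by rewrite -mulmxA -DA mulmxA mul_skew mul0mx.
exists (t 0 0).
apply: (@koszul_descent _ _ _ _ _ h g^T A h _ (C - t 0 0 *: B^T)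
  (D - (t 0 0)%:M) 0 hK).
- exact: exact_mxM.
- exact: exact_mxM.
- rewrite raddfB mulmxBr pC mulmxBl -scalemxAl -trmx_mul -transition_det.
  by rewrite [(_ *: h)^T]linearZ /= scalerA mul_mx_scalar.
- by rewrite mulmxBr -scalemxAr -syzygies_koszul mulmxBl DA mul_scalar_mx.
- rewrite mulmx0 mul0mx mulmxBr tD {1}[t]mx11_scalar mul_scalar_mx.
  by rewrite mul_mx_scalar subrr.
Qed.
End Socle.

(** * Ideals of powers of variables *)

Section MonomialIdeals.
Variables (n : nat) (R : nzRingType).
Implicit Types (p q : {mpoly R[n]}) (m : 'X_{1..n}).

Definition mfilter (P : pred 'X_{1..n}) p : {mpoly R[n]} :=
  \sum_(m <- msupp p | P m) p@_m *: 'X_[m].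

Lemma mcoeff_mfilter P p m : (mfilter P p)@_m = if P m then p@_m else 0.
Proof.
rewrite /mfilter raddf_sum /=.
under eq_bigr => k _ do rewrite mcoeffZ mcoeffX.
case: ifP => Pm; last first.
  rewrite big1 // => k Pk; have [km|] := eqVneq k m; last by rewrite mulr0.
  by move: Pk; rewrite km Pm.
rewrite -big_filter.
have [ms|ms] := boolP (m \in msupp p); last first.
  rewrite (memN_msupp_eq0 ms) big1_seq // => k /andP[_].
  rewrite mem_filter => /andP[_ kp]; have [km|] := eqVneq k m; last by rewrite mulr0.
  by move: ms; rewrite -km kp.
rewrite (bigD1_seq m) /= ?filter_uniq ?msupp_uniq ?mem_filter ?Pm //.
by rewrite eqxx mulr1 big1 ?addr0 // => k /negPf->; rewrite mulr0.
Qed.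

Lemma mfilterC P p : p = mfilter P p + mfilter (predC P) p.
Proof.
apply/mpolyP => m; rewrite mcoeffD !mcoeff_mfilter /=.
by case: (P m); rewrite ?addr0 ?add0r.
Qed.

Lemma mcoeffMXn p i N m : (p * 'X_i ^+ N)@_m =
  if (m i < N)%N then 0 else p@_(m - U_(i) *+ N).
Proof.
rewrite mpolyXn; case: ifPn => [mN|]; last first.
  rewrite -leqNgt => Nm; have mE : m = (U_(i) *+ N + (m - U_(i) *+ N))%MM.
    apply/mnmP => j; rewrite mnmDE mnmBE mulmnE mnm1E.
    by have [<-|] := eqVneq i j; rewrite ?mul1n ?subnKC.
  by rewrite {1}mE mcoeffMX.
apply: memN_msupp_eq0; rewrite (perm_mem (msuppMX _ _)).
apply/mapP => -[k _ mE]; move: mN; rewrite mE mnmDE mulmnE mnm1E eqxx mul1n.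
by rewrite ltnNge leq_addr.
Qed.

Lemma mulXn_exists p i N : (forall m, (m i < N)%N -> p@_m = 0) ->
  exists q, p = q * 'X_i ^+ N.
Proof.
move=> pN; exists (\sum_(m <- msupp p) p@_m *: 'X_[m - U_(i) *+ N]).
rewrite mulr_suml [LHS]mpolyE; apply: eq_big_seq => m mp.
rewrite -scalerAl mpolyXn -mpolyXD submK //.
apply/mnm_lepP => j; rewrite mulmnE mnm1E.
have [<-|//] := eqVneq i j; rewrite mul1n leqNgt.
by apply: contraTN mp => /pN/eqP; rewrite mcoeff_eq0.
Qed.

Lemma mulXn_inj i N : injective (fun p => p * 'X_i ^+ N).
Proof.
move=> p q /= pq; apply/mpolyP => m.
by rewrite -(mcoeffMX p (U_(i) *+ N)) -(mcoeffMX q (U_(i) *+ N)) -mpolyXn pq.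
Qed.

Lemma mulXn_regular2 i j M N p q : i != j ->
  p * 'X_j ^+ M = q * 'X_i ^+ N -> exists r, p = r * 'X_i ^+ N.
Proof.
move=> ij pq; apply: mulXn_exists => m mN.
rewrite -(mcoeffMX p (U_(j) *+ M)) -mpolyXn pq mcoeffMXn mnmDE mulmnE mnm1E.
by rewrite eq_sym (negPf ij) mN.
Qed.

(** Multiplication by a power of [X_k] leaves the exponents at [i] and [j] alone, so each monomial
    of [p] not divisible by [X_i^M] is divisible by [X_j^N]. *)
Lemma mulXn_regular3 i j k L M N p q r : i != j -> i != k -> j != k ->
  p * 'X_k ^+ L = q * 'X_i ^+ M + r * 'X_j ^+ N ->
  exists q' r', p = q' * 'X_i ^+ M + r' * 'X_j ^+ N.
Proof.
move=> ij ik jk pqr; pose P m := (M <= m i)%N.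
have [q' qE] : exists q', mfilter P p = q' * 'X_i ^+ M.
  by apply: mulXn_exists => m mi; rewrite mcoeff_mfilter /P leqNgt mi.
have [r' rE] : exists r', mfilter (predC P) p = r' * 'X_j ^+ N.
  apply: mulXn_exists => m mN; rewrite mcoeff_mfilter /P /= -ltnNge.
  case: ifP => // mM.
  rewrite -(mcoeffMX p (U_(k) *+ L)) -mpolyXn pqr mcoeffD !mcoeffMXn !mnmDE.
  rewrite !mulmnE !mnm1E ![k == _]eq_sym (negPf ik) (negPf jk) /= !add0n.
  by rewrite mM mN addr0.
by exists q', r'; rewrite -qE -rE -mfilterC.
Qed.
End MonomialIdeals.

Lemma mem_ideal_Xn (R : nzRingType) (N : nat) (p : {mpoly R[3]}) :
  (forall m : 'X_{1..3}, (forall i, m i < N)%N -> p@_m = 0) ->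
  exists q : 'I_3 -> {mpoly R[3]}, p = \sum_i q i * 'X_i ^+ N.
Proof.
move=> p0; pose P i (m : 'X_{1..3}) := (N <= m i)%N.
have [q0 q0E] : exists q, mfilter (P o0) p = q * 'X_o0 ^+ N.
  by apply: mulXn_exists => m mi; rewrite mcoeff_mfilter /P leqNgt mi.
set p1 := mfilter (predC (P o0)) p.
have [q1 q1E] : exists q, mfilter (P o1) p1 = q * 'X_o1 ^+ N.
  by apply: mulXn_exists => m mi; rewrite mcoeff_mfilter /P leqNgt mi.
have [q2 q2E] : exists q, mfilter (predC (P o1)) p1 = q * 'X_o2 ^+ N.
  apply: mulXn_exists => m m2; rewrite !mcoeff_mfilter /P /= -!ltnNge.
  case: ifP => // m1; case: ifP => // m0; apply: p0.
  by elim/ord3_ind.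
exists (fun i => [:: q0; q1; q2]`_i); rewrite sum3 /= -q0E -q1E -q2E.
by rewrite -addrA -mfilterC -mfilterC.
Qed.

Lemma koszul_exact_Xn (K : idomainType) (N : nat) :
  koszul_exact (\row_i 'X_i ^+ N : 'rV[{mpoly K[3]}]_3).
Proof.
set a := \row_i _.
have aE i : a 0 i = 'X_i ^+ N by rewrite mxE.
split.
- apply/rV0Pn; exists o0; rewrite aE; apply/eqP => X0.
  have /(_ 1 0) := @mulXn_inj 3 K o0 N; rewrite !X0 !mulr0 => /(_ erefl)/eqP.
  by rewrite oner_eq0.
- move=> c; split; last by case=> u ->; rewrite -mulmxA skewK mulmx0.
  move=> /matrixP/(_ 0 0); rewrite mxE sum3 !mxE => ca.
  (* Eliminating the last coordinate leaves a relation between two powers only. *)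
  have [|al [be c2]] := @mulXn_regular3 3 K o0 o1 o2 N N N
    (c 0 o2) (- c 0 o0) (- c 0 o1) isT isT isT.
    by apply/eqP; rewrite -subr_eq0 -ca; apply/eqP; ring.
  have [|ga c0] := @mulXn_regular2 3 K o1 o0 N N (c 0 o0 + al * 'X_o2 ^+ N)
     (- (c 0 o1 + be * 'X_o2 ^+ N)) isT.
    by apply/eqP; rewrite -subr_eq0 -ca c2; apply/eqP; ring.
  have c1 : c 0 o1 + be * 'X_o2 ^+ N = - ga * 'X_o0 ^+ N.
    apply: (@mulXn_inj 3 K o1 N); apply/eqP; rewrite -subr_eq0 /= -ca c2.
    rewrite -[c 0 o0](addrK (al * 'X_o2 ^+ N)) c0; apply/eqP; ring.
  exists (\row_j [:: be; - al; - ga]`_j); apply/rowP; elim/ord3_ind.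
  + rewrite -[c 0 o0](addrK (al * 'X_o2 ^+ N)) c0 mxE sum3 ?mxE /= ?mxE; ring.
  + rewrite -[c 0 o1](addrK (be * 'X_o2 ^+ N)) c1 mxE sum3 ?mxE /= ?mxE; ring.
  + rewrite c2 mxE sum3 ?mxE /= ?mxE; ring.
- move=> c; split; last by case=> u ->; rewrite -mulmxA mul_skew mulmx0.
  move=> /skew_eq0_tr/matrixP ca.
  have caE i j : c 0 i * 'X_j ^+ N = 'X_i ^+ N * c 0 j.
    by move: (ca i j); rewrite !mxE !big_ord1 !mxE.
  have [|r c0] := @mulXn_regular2 3 K o0 o1 N N (c 0 o0) (c 0 o1) isT.
    by rewrite caE mulrC.
  exists r%:M; rewrite mul_scalar_mx; apply/rowP => i; rewrite !mxE.
  by apply: (@mulXn_inj 3 K o0 N); rewrite /= caE c0; ring.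
Qed.

(** * Depth of the Jacobian ideal of a reduced curve *)

Section Gradient.
Variable K : numFieldType.
Local Notation S := {mpoly K[3]}.
Implicit Types (f p : S).

Definition grad f : 'rV[S]_3 := \row_i f^`M(i).

(** In characteristic zero, the derivative by a variable of the leading monomial is nonzero and of
    smaller size. *)
Lemma mderiv_closed_const (P : S -> Prop) f :
  (forall p i, P p -> P p^`M(i)) -> P f -> f != 0 ->
  exists2 c : K, c != 0 & P c%:MP.
Proof.
move=> Pd; have [k] := ubnP (msize f); elim: k f => // k IHk f fk Pf f0.
have [f1|f1] := leqP (msize f) 1.
  have fE := msize1_polyC f1; exists (f@_0); last by rewrite -fE.
  by apply: contraNneq f0 => c0; rewrite fE c0.
have := mlead_supp f0; set m := mlead f => mf.
have [i mi] : exists i, m i != 0%N.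
  apply/existsP; rewrite -negb_forall; apply/negP => /forallP m0.
  move: f1; rewrite -(mlead_deg f0) -/m mdegE big1 // => i _.
  exact/eqP/m0.
apply: (IHk f^`M(i)); last 2 first.
- exact: Pd.
- apply/eqP => /(congr1 (mcoeff (m - U_(i)))); rewrite mcoeff_mderiv mcoeff0.
  rewrite submK ?lep1mP // mnmBE mnm1E eqxx => /eqP.
  by rewrite mulrn_eq0 /= mcoeff_eq0 mf.
rewrite -ltnS (leq_trans _ fk) // ltnS msizeE.
have f_gt0 : (0 < msize f)%N by apply: leq_trans f1.
suff : (\max_(m0 <- msupp f^`M(i)) (mdeg m0).+1 <= (msize f).-1)%N.
  by rewrite -ltnS prednK.
apply/bigmax_leqP_seq => l lf _; rewrite -ltnS prednK //.
have /msize_mdeg_lt : (l + U_(i))%MM \in msupp f.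
  move: lf; rewrite !mcoeff_msupp mcoeff_mderiv; apply: contraNneq => ->.
  by rewrite mul0rn.
by rewrite mdegD mdeg1 addn1.
Qed.

Lemma euler (d : nat) f : f \is d.-homog -> \sum_i 'X_i * f^`M(i) = f *+ d.
Proof.
move=> fd; have E m : \sum_i 'X_i * ('X_[m] : S)^`M(i) = 'X_[m] *+ mdeg m.
  rewrite mdegE -sumrMnr; apply: eq_bigr => i _; rewrite mderivX -scalerAr scaler_nat.
  have [->|mi] := eqVneq (m i) 0%N; first by rewrite !mulr0n.
  by rewrite -mpolyXD addmC submK // lep1mP.
rewrite [in LHS](mpolyE f) [in RHS](mpolyE f) -sumrMnl.
under eq_bigr => i _ do rewrite raddf_sum mulr_sumr.
rewrite exchange_big; apply: eq_big_seq => m mf /=.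
under eq_bigr => i _ do rewrite mderivZ -scalerAr.
by rewrite -scaler_sumr E scalerMnr (dhomog_mf fd mf).
Qed.

(* The ideal [(f) : s] is stable under derivation because [f] is reduced, and it
   contains [f]; repeated derivation then yields a nonzero constant. *)
Lemma reduced_dvd_mderiv f s : reduced f ->
  (forall i, exists q, s * f^`M(i) = q * f) -> exists q, s = q * f.
Proof.
move=> [f0 fred] sf.
have [|||c c0 [q cq]] := @mderiv_closed_const (fun p => exists q, s * p = q * f) f.
- move=> p i [q spq]; have [r sr] := sf i; apply: (fred _ 2%N).
  (* Differentiating [s * p = q * f] and multiplying by [s] times the derivative of [p] shows that
     the square of the latter product is a multiple of [f]. *)
  exists (p^`M(i) * (s * q^`M(i) + q * r - s^`M(i) * q)).
  have := congr1 (mderiv i) spq; rewrite !mderivM => dq.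
  transitivity (p^`M(i) * (s * (s^`M(i) * p + s * p^`M(i)) - s^`M(i) * (s * p))).
    by ring.
  rewrite dq spq.
  transitivity (p^`M(i) * (s * q^`M(i) * f + q * (s * f^`M(i)) - s^`M(i) * q * f)).
    by ring.
  by rewrite sr; ring.
- by exists s.
- by [].
exists (c^-1%:MP * q); rewrite -mulrA -cq mulrCA -mpolyCM mulVf //.
by rewrite mulr1.
Qed.

(** For [c] parallel to the gradient, let [s] be its contraction with the variables. By Euler, [s]
    times the [j]-th partial is [d * f * c_j], so [f] divides [s], and cancelling [f] shows [c] to
    be a multiple of the gradient. *)
Lemma grad_depth2 (d : nat) f : (0 < d)%N -> f \is d.-homog -> reduced f ->
  exact_mx (grad f) (skew3 (grad f)).
Proof.
move=> d0 fd fred c; split; last first.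
  by case=> u ->; rewrite -mulmxA mul_skew mulmx0.
move=> /skew_eq0_tr/matrixP cf.
have cfE i j : c 0 i * f^`M(j) = f^`M(i) * c 0 j.
  by move: (cf i j); rewrite !mxE !big_ord1 !mxE.
pose s : S := \sum_i 'X_i * c 0 i.
have sf j : s * f^`M(j) = f * c 0 j *+ d.
  rewrite -mulrnAl -(euler fd) !mulr_suml; apply: eq_bigr => i _.
  by rewrite -!mulrA cfE.
have [|q sq] := reduced_dvd_mderiv (s := s) fred.
  by move=> i; exists (c 0 i *+ d); rewrite sf mulrC mulrnAl.
exists ((d%:R^-1 : K)%:MP * q)%:M; rewrite mul_scalar_mx; apply/rowP => j.
rewrite !mxE; apply: (mulfI fred.1); have := sf j; rewrite sq => fq.
transitivity ((d%:R^-1 : K)%:MP * (f * c 0 j *+ d)); last by rewrite -fq; ring.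
rewrite -(mulr_natl (f * _)) -mpolyC_nat mulrA -mpolyCM mulVf ?mul1r //.
by rewrite pnatr_eq0 -lt0n.
Qed.
End Gradient.

(** * The kernel generator has no zero *)

Section IdealQuotient.
Local Open Scope quotient_scope.
Variables (S : comNzRingType) (P : S -> Prop).
Hypotheses (P0 : P 0) (PB : forall x y, P x -> P y -> P (x - y)).
Hypotheses (PM : forall a x, P x -> P (a * x)) (P1 : ~ P 1).

Definition mem_ideal : {pred S} := fun x => `[< P x >].

Lemma mem_ideal_closed : idealr_closed mem_ideal.
Proof.
split=> [||a x y /asboolP Px /asboolP Py].
- exact/asboolP.
- by apply/asboolP.
- apply/asboolP; rewrite -[y]opprK; apply: PB; first exact: PM.
  by rewrite -[- y]add0r; apply: PB.
Qed.

HB.instance Definition _ := isIdealr.Build S mem_ideal mem_ideal_closed.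

Lemma ideal_quotient :
  exists (Q : comNzRingType) (pi : {rmorphism S -> Q}), forall x, pi x = 0 <-> P x.
Proof.
pose Q : comNzRingType := {ideal_quot mem_ideal}.
pose pi : {rmorphism S -> Q} := \pi_({ideal_quot mem_ideal}).
have piE x y : (pi x == pi y) = (x - y \in mem_ideal) by rewrite Quotient.idealrBE.
exists Q, pi => x; rewrite -(rmorph0 pi).
split=> [/eqP|Px]; first by rewrite piE subr0 => /asboolP.
by apply/eqP; rewrite piE subr0; apply/asboolP.
Qed.
End IdealQuotient.

(** * Exactness under extension of scalars *)

Section BaseChange.
Variables (n : nat) (K : fieldType) (L : comNzRingType) (phi : {rmorphism K -> L}).
Local Notation S := {mpoly K[n]}.
Local Notation T := {mpoly L[n]}.
Local Notation Phi := (map_mpoly phi : S -> T).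

(** Sums of pure tensors, [T^m] being the tensor product of [L] and [S^m] over [K]. *)
Definition spanned (m : nat) (v : 'rV[T]_m) : Prop :=
  exists s : seq (L * 'rV[S]_m), v = \sum_(x <- s) x.1%:MP *: map_mx Phi x.2.

Lemma spanned_all (m : nat) (v : 'rV[T]_m) : spanned v.
Proof.
have spD u1 u2 : @spanned m u1 -> spanned u2 -> spanned (u1 + u2).
  by case=> s1 -> [s2 ->]; exists (s1 ++ s2); rewrite big_cat.
have sp0 : @spanned m 0 by exists [::]; rewrite big_nil.
rewrite [v]row_sum_delta; elim/big_ind: _ => // j _.
rewrite [v 0 j]mpolyE scaler_suml; elim/big_ind: _ => // k _.
exists [:: ((v 0 j)@_k, 'X_[k] *: delta_mx 0 j)]; rewrite big_seq1 /=.
rewrite -mul_mpolyC -scalerA; congr (_ *: _); apply/rowP => i.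
by rewrite !mxE rmorphM /= map_mpolyX rmorph_nat.
Qed.

(* When the [k t] are linearly independent over [K], a relation with
   coefficients [k t] is a family of relations over [S]; otherwise the number
   of terms can be decreased. *)
Lemma base_change_sum (l m p : nat) (D : 'M[S]_(l, m)) (E : 'M[S]_(m, p)) N
    (k : 'I_N -> L) (w : 'I_N -> 'rV[S]_m) : exact_mx D E ->
  (\sum_t (k t)%:MP *: map_mx Phi (w t)) *m map_mx Phi E = 0 ->
  exists u, \sum_t (k t)%:MP *: map_mx Phi (w t) = u *m map_mx Phi D.
Proof.
move=> DE; elim: N k w => [|N IHN] k w.
  by exists 0; rewrite big_ord0 mul0mx.
have [indep|dep] := pselect (forall c : 'I_N.+1 -> K,
    \sum_t phi (c t) * k t = 0 -> forall t, c t = 0).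
  move=> wE; have wE0 t : w t *m E = 0.
    apply/rowP => j; rewrite [RHS]mxE; apply/mpolyP => q; rewrite mcoeff0.
    apply: (indep (fun t => ((w t *m E) 0 j)@_q)); move/rowP/(_ j): wE.
    rewrite mulmx_suml summxE [RHS]mxE => /(congr1 (mcoeff q)).
    rewrite mcoeff0 raddf_sum /= => wEj.
    rewrite -[RHS]wEj; apply: eq_bigr => i _.
    by rewrite -scalemxAl -map_mxM !mxE mcoeffCM mcoeff_map_mpoly mulrC.
  have /fin_all_exists[u uE] t := (DE (w t)).1 (wE0 t).
  exists (\sum_t (k t)%:MP *: map_mx Phi (u t)); rewrite mulmx_suml.
  by apply: eq_bigr => t _; rewrite uE map_mxM scalemxAl.
have [c [ck [t0 ct0]]] : exists c : 'I_N.+1 -> K,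
    \sum_t phi (c t) * k t = 0 /\ exists t, c t != 0.
  apply: contrapT => nex; apply: dep => c ck t; apply/eqP/negPn/negP => ct.
  by apply: nex; exists c; split=> //; exists t.
pose r t := c t / c t0.
have kt0 : k t0 = - \sum_(t < N) phi (r (lift t0 t)) * k (lift t0 t).
  apply/eqP; rewrite -subr_eq0 opprK.
  have -> : k t0 = phi (r t0) * k t0 by rewrite /r divff // rmorph1 mul1r.
  rewrite -(bigD1_ord t0 (P := xpredT) (F := fun t => phi (r t) * k t)) //.
  have -> : \sum_t phi (r t) * k t = phi (c t0)^-1 * \sum_t phi (c t) * k t.
    rewrite mulr_sumr; apply: eq_bigr => t _.
    by rewrite /r rmorphM mulrA; congr (_ * _); rewrite mulrC.
  by rewrite ck mulr0.
have -> : \sum_t (k t)%:MP *: map_mx Phi (w t) = \sum_(t < N)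
    (k (lift t0 t))%:MP *: map_mx Phi (w (lift t0 t) - (r (lift t0 t))%:MP *: w t0).
  rewrite (bigD1_ord t0) //= kt0 raddfN raddf_sum /= -sumrN scaler_suml.
  rewrite -big_split /=; apply: eq_bigr => t _.
  rewrite map_mxB map_mxZ /= map_mpolyC scalerBr addrC; congr (_ + _).
  by rewrite scaleNr scalerA -mpolyCM mulrC.
exact: IHN.
Qed.

Lemma exact_mx_base_change (l m p : nat) (D : 'M[S]_(l, m)) (E : 'M[S]_(m, p)) :
  exact_mx D E -> exact_mx (map_mx Phi D) (map_mx Phi E).
Proof.
move=> DE v; split; last first.
  by case=> u ->; rewrite -mulmxA -map_mxM (exact_mxM DE) map_mx0 mulmx0.
have [s ->] := spanned_all v; rewrite (big_nth (0, 0)) big_mkord.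
exact: (base_change_sum (k := fun t => (nth (0, 0) s t).1)
  (w := fun t => (nth (0, 0) s t).2) DE).
Qed.
End BaseChange.

Lemma exact_mx_iso (S T : comNzRingType) (s : {rmorphism S -> T})
    (t : {rmorphism T -> S}) (l m n : nat) (D : 'M[S]_(l, m)) (E : 'M[S]_(m, n)) :
  cancel s t -> cancel t s -> exact_mx D E ->
  exact_mx (map_mx s D) (map_mx s E).
Proof.
move=> sK tK DE v.
have smK (a b : nat) (M : 'M[S]_(a, b)) : map_mx t (map_mx s M) = M.
  by apply/matrixP => i j; rewrite !mxE.
have tmK (a b : nat) (M : 'M[T]_(a, b)) : map_mx s (map_mx t M) = M.
  by apply/matrixP => i j; rewrite !mxE.
split=> [vE|[u ->]]; last by rewrite -mulmxA -map_mxM (exact_mxM DE) map_mx0 mulmx0.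
have /DE[u uE] : map_mx t v *m E = 0.
  by rewrite -[E]smK -map_mxM vE map_mx0.
by exists (map_mx s u); rewrite -map_mxM -uE tmK.
Qed.

Lemma row_scaler_exists (T : comNzRingType) (m : nat) (p q : T) (a b : 'rV[T]_m) :
  (forall x y, p * x + q * y = 0 -> exists z, x = q * z /\ y = - (p * z)) ->
  p *: a + q *: b = 0 -> exists c, a = q *: c /\ b = - (p *: c).
Proof.
move=> pq /rowP ab.
have /fin_all_exists[c cP] j : exists z, a 0 j = q * z /\ b 0 j = - (p * z).
  by apply: pq; move: (ab j); rewrite !mxE.
by exists (\row_j c j); split; apply/rowP => j; rewrite !mxE; case: (cP j).
Qed.

(* The vanishing of [Tor_3 (coker g, T/(p, q))], which the Koszul complex of
   the regular sequence [p, q] computes: if [h] vanished modulo [(p, q)], this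
   module would be [T/(p, q)]. *)
Lemma kernel_not_in_regular_pair (T : comNzRingType) (A : 'M[T]_3)
    (g h a b : 'rV[T]_3) (p q : T) :
  exact_mx A g^T -> exact_mx h A -> exact_mx (0 : 'M_(0, 1)) h ->
  (forall x y, p * x + q * y = 0 -> exists z, x = q * z /\ y = - (p * z)) ->
  (forall x, q * x = 0 -> x = 0) ->
  h = p *: a + q *: b -> exists u v, 1 = p * u + q * v.
Proof.
move=> syzA kerA h0 pq q0 hE.
have [c [aA bA]] : exists c, a *m A = q *: c /\ b *m A = - (p *: c).
  apply: row_scaler_exists => //.
  by rewrite !scalemxAl -mulmxDl -hE (exact_mxM kerA).
have /syzA[d cA] : c *m g^T = 0.
  apply/matrixP => k l; rewrite [RHS]mxE; apply: q0.
  have : (q *: c) *m g^T = 0 by rewrite -aA -mulmxA (exact_mxM syzA) mulmx0.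
  by rewrite -scalemxAl => /matrixP/(_ k l); rewrite !mxE.
have /kerA[u uh] : (a - q *: d) *m A = 0.
  by rewrite mulmxBl aA -scalemxAl -cA subrr.
have /kerA[v vh] : (b + p *: d) *m A = 0.
  by rewrite mulmxDl bA -scalemxAl -cA addNr.
(* Both vectors are now multiples of [h], while [p] times the first plus [q] times the second is [h]
   itself. *)
have /h0[w wE] : (1%:M - p *: u - q *: v) *m h = 0.
  rewrite !mulmxBl mul1mx -!scalemxAl -uh -vh hE.
  by apply/rowP => l; rewrite !mxE; ring.
exists (u 0 0), (v 0 0); move: wE; rewrite mulmx0 => /matrixP/(_ 0 0).
by rewrite !mxE /= => /eqP; rewrite -addrA -opprD subr_eq0 => /eqP.
Qed.

Section NoCommonZero.
Variables (L : comNzRingType) (i j k : 'I_3).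
Local Notation T := {mpoly L[3]}.
Implicit Types (y z : 'I_3 -> L) (P Q : T).
Hypothesis ijk : uniq [:: i; j; k].

Definition shift z : T -> T :=
  comp_mpoly [tuple 'X_l + (z l)%:MP * 'X_i | l < 3].

HB.instance Definition _ z := GRing.RMorphism.on (shift z).

Arguments shift : simpl never.

Lemma shiftX z l : shift z 'X_l = 'X_l + (z l)%:MP * 'X_i.
Proof. by rewrite /shift comp_mpolyXU -tnth_nth tnth_mktuple. Qed.

Lemma shiftC z c : shift z c%:MP = c%:MP.
Proof. exact: comp_mpolyC. Qed.

Lemma shiftK z : z i = 0 -> cancel (shift z) (shift (\- z)).
Proof.
move=> zi P; rewrite [in LHS](mpolyE P) (rmorph_sum (shift z)).
rewrite (rmorph_sum (shift (\- z))) [in RHS](mpolyE P).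
apply: eq_bigr => m _; rewrite -!mul_mpolyC !rmorphM /= !shiftC; congr (_ * _).
rewrite mpolyXE_id !rmorph_prod; apply: eq_bigr => l _.
rewrite !rmorphXn /= shiftX rmorphD rmorphM /= !shiftX shiftC /= zi oppr0 mpolyC0.
by rewrite mul0r addr0 mpolyCN mulNr addrNK.
Qed.

Definition eqmod P Q := exists a b, P - Q = 'X_j * a + 'X_k * b.

Lemma eqmod_refl P : eqmod P P.
Proof. by exists 0, 0; rewrite !mulr0 addr0 subrr. Qed.

Lemma eqmodD P P' Q Q' : eqmod P Q -> eqmod P' Q' -> eqmod (P + P') (Q + Q').
Proof.
move=> [a [b PQ]] [a' [b' PQ']]; exists (a + a'), (b + b').
by rewrite opprD addrACA PQ PQ'; ring.
Qed.

Lemma eqmodM P P' Q Q' : eqmod P Q -> eqmod P' Q' -> eqmod (P * P') (Q * Q').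
Proof.
move=> [a [b PQ]] [a' [b' PQ']]; exists (a * P' + Q * a'), (b * P' + Q * b').
have -> : P * P' - Q * Q' = (P - Q) * P' + Q * (P' - Q') by ring.
by rewrite PQ PQ'; ring.
Qed.

Lemma eqmodX P Q n : eqmod P Q -> eqmod (P ^+ n) (Q ^+ n).
Proof.
move=> PQ; elim: n => [|n IHn]; first exact: eqmod_refl.
by rewrite !exprS; apply: eqmodM.
Qed.

(** Modulo [X_j] and [X_k] each variable [X_l] goes to [y l] times [X_i], so a form goes to its
    value at [y] times a power of [X_i]. *)
Lemma shift_eqmod y (d : nat) P : y i = 1 -> P \is d.-homog ->
  eqmod (shift (fun l => if l == i then 0 else y l) P) (P.@[y]%:MP * 'X_i ^+ d).
Proof.
move=> yi Pd; rewrite mevalE raddf_sum /= mulr_suml [in shift _ P](mpolyE P).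
rewrite (rmorph_sum (shift _)).
rewrite !big_seq; elim/big_rec2: _ => [|m P1 P2 mP]; first exact: eqmod_refl.
apply: eqmodD; rewrite -mul_mpolyC rmorphM /= shiftC mpolyCM -mulrA.
apply: eqmodM; first exact: eqmod_refl.
have <- : mdeg m = d := dhomog_mf Pd mP.
rewrite mpolyXE_id rmorph_prod rmorph_prod /= mdegE.
rewrite -prodrXr -big_split /=; elim/big_rec2: _ => [|l Q1 Q2 _].
  exact: eqmod_refl.
apply: eqmodM; rewrite !rmorphXn -exprMn; apply: eqmodX; rewrite /= shiftX.
have [->|li] := eqVneq l i.
  by rewrite yi mpolyC0 mul0r addr0 mul1r; apply: eqmod_refl.
exists (if l == j then 1 else 0), (if l == k then 1 else 0).
have : l = j \/ l = k.
  move: ijk li; rewrite /= !inE negb_or.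
  elim/ord3_ind: l; elim/ord3_ind: i; elim/ord3_ind: j; elim/ord3_ind: k => //=;
    by [left|right].
have jk : j != k by move: ijk; rewrite /= !inE => /and3P[].
case=> ->; rewrite eqxx ?(negPf jk) ?[k == j]eq_sym ?(negPf jk); ring.
Qed.

End NoCommonZero.

Lemma dhomog_map_mpoly (n d : nat) (K L : nzRingType) (phi : {rmorphism K -> L})
    (p : {mpoly K[n]}) :
  p \is d.-homog -> map_mpoly phi p \is d.-homog.
Proof.
move=> pd; apply/dhomogP => m; rewrite mcoeff_msupp mcoeff_map_mpoly => pm.
apply: (dhomog_mf pd); rewrite mcoeff_msupp; apply: contraNneq pm => ->.
by rewrite raddf0.
Qed.

Lemma regular_pairX (n : nat) (L : comNzRingType) (j k : 'I_n)
    (x y : {mpoly L[n]}) :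
  j != k -> 'X_j * x + 'X_k * y = 0 -> exists z, x = 'X_k * z /\ y = - ('X_j * z).
Proof.
move=> jk /eqP; rewrite addr_eq0 => /eqP xy.
rewrite eq_sym in jk; have [|r xr] := @mulXn_regular2 n L k j 1 1 x (- y) jk.
  by rewrite !expr1 mulrC xy mulNr mulrC.
exists r; rewrite xr expr1 mulrC; split=> //.
apply: (@mulXn_inj n L k 1); rewrite /= !expr1 mulrC -[LHS]opprK -xy xr expr1.
by rewrite mulNr -mulrA.
Qed.

(* The change of variables [shift] moves the zero [y] to the coordinate point
   where [X_j] and [X_k] vanish. *)
Lemma kernel_no_zero (K : fieldType) (L : comNzRingType)
    (phi : {rmorphism K -> L}) (A : 'M[{mpoly K[3]}]_3)
    (g h : 'rV[{mpoly K[3]}]_3) (i : 'I_3) (y : 'I_3 -> L) :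
  exact_mx A g^T -> exact_mx h A -> h != 0 ->
  (forall l, exists d, h 0 l \is d.-homog) -> y i = 1 ->
  ~ forall l, (map_mpoly phi (h 0 l)).@[y] = 0.
Proof.
move=> syzA kerA h0 hd yi hy.
have [j [k ijk]] : exists j k, uniq [:: i; j; k].
  by elim/ord3_ind: i {yi}; [exists o1, o2 | exists o0, o2 | exists o0, o1].
have jk : j != k by move: ijk; rewrite /= !inE => /and3P[].
pose z l := if l == i then 0 else y l; have zi : z i = 0 by rewrite /z eqxx.
pose s := shift i z; pose t := shift i (\- z).
have sK : cancel s t by apply: shiftK.
have tK : cancel t s.
  have -> : s = shift i (\- (\- z)).
    by congr (shift i _); apply/funext => l /=; rewrite opprK.
  by apply: shiftK; rewrite /= zi oppr0.
pose F (p : {mpoly K[3]}) := s (map_mpoly phi p).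
have FE (m n : nat) (M : 'M_(m, n)) :
    map_mx s (map_mx (map_mpoly phi) M) = map_mx F M.
  by apply/matrixP => a b; rewrite !mxE.
have Fex (a b c : nat) (D : 'M_(a, b)) (E : 'M_(b, c)) :
    exact_mx D E -> exact_mx (map_mx F D) (map_mx F E).
  by move=> DE; rewrite -!FE; apply/(exact_mx_iso sK tK)/exact_mx_base_change.
(* Injectivity is phrased as exactness at a matrix without rows, which survives base change; over
   [L], which may have zero divisors, [h != 0] would not suffice. *)
have h0ex : exact_mx (0 : 'M_(0, 1)) h.
  move=> v; split=> [vh|[u ->]]; last by rewrite mulmx0 mul0mx.
  by exists 0; rewrite mul0mx; apply: (mulmx_row_inj h0); rewrite mul0mx.
have /fin_all_exists[a /fin_all_exists[b hab]] l :
    exists a b, F (h 0 l) = 'X_j * a + 'X_k * b.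
  have [d hld] := hd l.
  have := shift_eqmod ijk yi (dhomog_map_mpoly phi hld).
  by rewrite hy mpolyC0 mul0r /eqmod subr0.
have [||||||u [v uv1]] := @kernel_not_in_regular_pair _ (map_mx F A) (map_mx F g)
    (map_mx F h) (\row_l a l) (\row_l b l) 'X_j 'X_k.
- by rewrite map_trmx; apply: Fex.
- exact: Fex.
- by have := Fex _ _ _ _ _ h0ex; rewrite -FE !map_mx0.
- by move=> p q; apply: regular_pairX.
- move=> p /eqP; rewrite mulrC => /eqP pk; apply: (@mulXn_inj 3 L k 1).
  by rewrite /= expr1 pk mul0r.
- by apply/rowP => l; rewrite !mxE hab.
have X0 l (p : {mpoly L[3]}) : ('X_l * p)@_0 = 0.
  by rewrite mulrC -['X_l]expr1 mcoeffMXn mnm0E.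
have := congr1 (mcoeff 0) uv1; rewrite mcoeffD !X0 addr0 mcoeff1 eqxx => /eqP.
by rewrite oner_eq0.
Qed.

Section Homogenization.
Variables (n : nat) (K : fieldType) (i : 'I_n).
Local Notation S := {mpoly K[n]}.
Local Notation F := {fraction S}.
Local Notation x := (tofrac ('X_i : S)).

(* [p(x / x_i)]. *)
Definition homogenize : S -> F :=
  mmap (@tofrac S \o @mpolyC n K) (fun l => tofrac 'X_l / x).

HB.instance Definition _ := GRing.RMorphism.on homogenize.

Arguments homogenize : simpl never.

Lemma fracX_neq0 : x != 0.
Proof.
rewrite tofrac_eq0; apply/eqP => X0.
have /(_ 1 0) := @mulXn_inj n K i 1; rewrite !expr1 X0 !mulr0 => /(_ erefl)/eqP.
by rewrite oner_eq0.
Qed.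

Lemma homogenizeX m : homogenize 'X_[m] = tofrac 'X_[m] / x ^+ mdeg m.
Proof.
apply: (canRL (mulfK (expf_neq0 _ fracX_neq0))).
rewrite /homogenize mmapX /mmap1 [X in _ = tofrac X]mpolyXE_id.
rewrite rmorph_prod mdegE -prodrXr -big_split /=.
by apply: eq_bigr => l _; rewrite -exprMn divfK ?fracX_neq0 // rmorphXn.
Qed.

Lemma homogenizeC c : homogenize c%:MP = tofrac c%:MP.
Proof. by rewrite /homogenize mmapC. Qed.

Lemma homogenize_dhomog (d : nat) (p : S) :
  p \is d.-homog -> homogenize p = tofrac p / x ^+ d.
Proof.
move=> pd; rewrite [in LHS](mpolyE p) [in RHS](mpolyE p) (rmorph_sum homogenize).
rewrite rmorph_sum mulr_suml; apply: eq_big_seq => m mp.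
rewrite -mul_mpolyC (rmorphM homogenize) /= homogenizeC homogenizeX rmorphM mulrA.
by have -> : mdeg m = d := dhomog_mf pd mp.
Qed.

Lemma homogenize_bounded (p : S) : exists N (q : S), homogenize p * x ^+ N = tofrac q.
Proof.
elim/mpolyind: p => [|c m p _ _ [N [q pq]]].
  by exists 0%N, 0; rewrite (rmorph0 homogenize) mul0r tofrac0.
exists (mdeg m + N)%N, (c%:MP * 'X_[m] * 'X_i ^+ N + q * 'X_i ^+ mdeg m).
rewrite -mul_mpolyC (rmorphD homogenize) (rmorphM homogenize) /=.
rewrite homogenizeC homogenizeX.
rewrite rmorphD !rmorphM !rmorphXn /= -pq exprD mulrDl -!mulrA; congr (_ + _).
  by rewrite mulKf ?expf_neq0 ?fracX_neq0.
by rewrite [x ^+ mdeg m * _]mulrC.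
Qed.
End Homogenization.

(* [K[x,y,z]/(h, x_i - 1)] vanishes because it would carry a common zero of
   [h]; homogenizing [1 \in (h, x_i - 1)] gives the power of [x_i]. *)
Lemma kernel_primary (K : fieldType) (A : 'M[{mpoly K[3]}]_3)
    (g h : 'rV[{mpoly K[3]}]_3) (i : 'I_3) :
  exact_mx A g^T -> exact_mx h A -> h != 0 ->
  (forall l, exists d, h 0 l \is d.-homog) ->
  exists N u, ('X_i ^+ N)%:M = u *m h^T.
Proof.
move=> syzA kerA h0 hd.
pose P (p : {mpoly K[3]}) :=
  exists (u : 'rV_3) q, p = (u *m h^T) 0 0 + q * ('X_i - 1).
have [P1|nP1] := pselect (P 1); last first.
  have [||||L [pi piP]] := @ideal_quotient {mpoly K[3]} P.
  - by exists 0, 0; rewrite mul0mx mxE mul0r addr0.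
  - move=> p q [u [a ->]] [v [b ->]]; exists (u - v), (a - b).
    have -> : ((u - v) *m h^T) 0 0 = (u *m h^T) 0 0 - (v *m h^T) 0 0.
      by rewrite mulmxBl !mxE.
    by ring.
  - move=> a p [u [q ->]]; exists (a *: u), (a * q).
    have -> : ((a *: u) *m h^T) 0 0 = a * (u *m h^T) 0 0.
      by rewrite -scalemxAl [LHS]mxE.
    by ring.
  - exact: nP1.
  pose phi : {rmorphism K -> L} := pi \o @mpolyC 3 K.
  exfalso; apply: (@kernel_no_zero K L phi A g h i (fun l => pi 'X_l)) => //.
    apply/eqP; rewrite -subr_eq0 -(rmorph1 pi) -rmorphB; apply/eqP/piP.
    by exists 0, 1; rewrite mul0mx mxE mul1r add0r.
  move=> l; have -> : (map_mpoly phi (h 0 l)).@[fun l => pi 'X_l] = pi (h 0 l).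
    rewrite [in LHS](mpolyE (h 0 l)) [in RHS](mpolyE (h 0 l)).
    rewrite (rmorph_sum (map_mpoly phi)) (rmorph_sum (meval _)) (rmorph_sum pi).
    apply: eq_bigr => m _.
    rewrite /= map_mpolyZ map_mpolyX mevalZ mevalX -mul_mpolyC rmorphM; congr (_ * _).
    by rewrite mpolyXE_id rmorph_prod; apply: eq_bigr => k _; rewrite rmorphXn.
  apply/piP; exists (delta_mx 0 l), 0.
  by rewrite -rowE !mxE mul0r addr0.
have [u [q one]] := P1.
(* The factor ['X_i - 1] becomes [x_i / x_i - 1 = 0], leaving only the terms in [h]. *)
have H1 : \sum_l homogenize i (u 0 l) * homogenize i (h 0 l) = 1.
  rewrite -(rmorph1 (homogenize i)) one (rmorphD (homogenize i)).
  rewrite (rmorphM (homogenize i)).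
  rewrite (rmorphB (homogenize i)) (rmorph1 (homogenize i)) /= homogenizeX mdeg1 expr1.
  rewrite divff ?fracX_neq0 // subrr mulr0 addr0 mxE (rmorph_sum (homogenize i)).
  by apply: eq_bigr => l _; rewrite mxE (rmorphM (homogenize i)).
have /fin_all_exists[d dP] := hd.
have /fin_all_exists[N /fin_all_exists[v vP]] l := homogenize_bounded i (u 0 l).
(* [N l] clears the denominators from [u], [d l] those from [h]; the sum is a common bound. *)
pose M := (\sum_l (N l + d l))%N.
have NM l : (N l + d l <= M)%N by rewrite /M (bigD1 l) //= leq_addr.
exists M, (\row_l (v l * 'X_i ^+ (M - (N l + d l)))).
apply/matrixP => a b; rewrite !ord1 mxE eqxx mulr1n [RHS]mxE; apply/eqP.
rewrite -tofrac_eq; apply/eqP.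
rewrite rmorphXn /= -[LHS]mul1r -H1 mulr_suml rmorph_sum; apply: eq_bigr => l _.
rewrite !mxE (homogenize_dhomog i (dP l)) !rmorphM rmorphXn /= -vP.
have {1}-> : M = (N l + (M - (N l + d l)) + d l)%N by rewrite addnAC subnKC.
have cancel (E : fieldType) (s t z N' M' : E) :
    z != 0 -> s * (t / z) * (N' * M' * z) = s * N' * M' * t by move=> z0; field.
by rewrite !exprD cancel ?expf_neq0 ?fracX_neq0.
Qed.

(** * Graded matrices *)

Section Grading.
Variable K : fieldType.
Local Notation S := {mpoly K[3]}.
Implicit Types (p q : S).

Lemma in_degree0 k : in_degree k (0 : S).
Proof. by case: k => n /=; rewrite ?dhomog0. Qed.

Lemma in_degreeD k p q : in_degree k p -> in_degree k q -> in_degree k (p + q).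
Proof.
case: k => n /=; first exact: dhomogD.
by move=> /eqP-> /eqP->; rewrite addr0.
Qed.

Lemma in_degreeN k p : in_degree k p -> in_degree k (- p).
Proof. by case: k => n /=; rewrite ?dhomogN ?oppr_eq0. Qed.

Lemma in_degreeB k p q : in_degree k p -> in_degree k q -> in_degree k (p - q).
Proof. by move=> pk qk; apply: in_degreeD => //; apply: in_degreeN. Qed.

Lemma in_degreeM (j k : int) p q :
  in_degree j p -> in_degree k q -> in_degree (j + k) (p * q).
Proof.
case: j => j /= pj; last by rewrite (eqP pj) mul0r in_degree0.
case: k => k /= qk; last by rewrite (eqP qk) mulr0 in_degree0.
exact: dhomogM.
Qed.

Lemma in_degree_sum (I : finType) k (F : I -> S) :
  (forall i, in_degree k (F i)) -> in_degree k (\sum_i F i).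
Proof.
move=> Fk; elim/big_ind: _ => //; [exact: in_degree0 | exact: in_degreeD].
Qed.

Lemma in_degreeC (c : K) : in_degree 0 (c%:MP : S).
Proof. by rewrite /= -[c%:MP]mulr1 mul_mpolyC dhomogZ ?dhomog1. Qed.

Lemma in_degree0_const p : in_degree 0 p -> p = (p@_0)%:MP.
Proof.
move=> /= p0; apply/mpolyP => m; rewrite mcoeffC.
have [->|m0] := eqVneq m 0%MM; first by rewrite mulr1.
by rewrite mulr0 (dhomog_nemf_coeff p0) // mdeg_eq0.
Qed.

Lemma in_degree_coef0 k p : in_degree k p -> k != 0 -> p@_0 = 0.
Proof.
case: k => [k|k] /=; last by move=> /eqP-> _; rewrite mcoeff0.
move=> pk k0; apply: (dhomog_nemf_coeff pk).
by rewrite -[X in X != _]/(mdeg (0%MM : 'X_{1..3})) mdeg0 eq_sym.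
Qed.

Definition component k p : S := if k is Posz n then pihomog mdeg n p else 0.

Lemma component_is_linear k : linear (component k).
Proof.
by case: k => n a p q /=; [rewrite linearP | rewrite scaler0 addr0].
Qed.

HB.instance Definition _ k :=
  GRing.isLinear.Build K S S _ (component k) (component_is_linear k).

Arguments component : simpl never.

Lemma in_degree_component k p : in_degree k (component k p).
Proof. by case: k => n /=; rewrite ?pihomogP. Qed.

Lemma component_in_degree (j k : int) p :
  in_degree k p -> component j p = if j == k then p else 0.
Proof.
case: k => k /= pk; last by rewrite (eqP pk) raddf0 if_same.
case: j => j //=; rewrite /component eqz_nat.
have [->|jk] := eqVneq j k; first exact: pihomog_dE.
by apply: pihomog_ne0 pk; rewrite eq_sym.
Qed.

Lemma componentM (j k : int) p q :
  in_degree k q -> component (j + k) (p * q) = component j p * q.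
Proof.
move=> qk; rewrite (mpolyE p) mulr_suml !linear_sum /= mulr_suml.
apply: eq_bigr => m _; rewrite -scalerAl !linearZ /= -scalerAl; congr (_ *: _).
have mX : in_degree (mdeg m) ('X_[m] : S) by rewrite /= dhomogX.
rewrite (component_in_degree _ mX) (component_in_degree _ (in_degreeM mX qk)).
by rewrite (inj_eq (addIr _)); case: ifP; rewrite ?mul0r.
Qed.

Lemma in_degree_div (j k : int) p q :
  q != 0 -> in_degree k q -> in_degree (j + k) (p * q) -> in_degree j p.
Proof.
move=> q0 qk pqk; have := componentM j p qk.
rewrite (component_in_degree _ pqk) eqxx => /(mulIf q0)->.
exact: in_degree_component.
Qed.

Lemma irrelevantP p : irrelevant p <-> p@_0 = 0.
Proof.
split=> [[a ->]|p0].
  rewrite raddf_sum big1 //= => i _.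
  by rewrite -['X_i]expr1 mcoeffMXn mnm0E.
have [m m0|q ->] := @mem_ideal_Xn K 1 p; last first.
  by exists q; apply: eq_bigr => i _; rewrite expr1.
rewrite -[RHS]p0; congr (_@__); apply/mnmP => i; rewrite mnm0E.
by apply/eqP; rewrite -leqn0 -ltnS m0.
Qed.

(* The matrices of degree-preserving maps from the sum of the [S(a i)] to the
   sum of the [S(b j)]. *)
Definition graded_mx (m n : nat) (a : 'I_m -> int) (b : 'I_n -> int)
  (M : 'M[S]_(m, n)) : Prop := forall i j, in_degree (b j - a i) (M i j).

(** [C] and [D] being graded, only the components of [U] in the prescribed degrees contribute to the
    product. *)
Lemma graded_mx_factor (l m n : nat) (a : 'I_l -> int) (b : 'I_m -> int)
    (c : 'I_n -> int) C (U : 'M_(l, m)) D :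
  graded_mx a c C -> graded_mx b c D -> C = U *m D ->
  exists2 V, graded_mx a b V & C = V *m D.
Proof.
move=> Cac Dbc CE; exists (\matrix_(i, j) component (b j - a i) (U i j)).
  by move=> i j; rewrite mxE; apply: in_degree_component.
apply/matrixP => i j; have := component_in_degree (c j - a i) (Cac i j).
rewrite eqxx => <-; rewrite CE !mxE raddf_sum; apply: eq_bigr => k _ /=.
rewrite mxE -(componentM _ _ (Dbc k j)); congr (component _ _); ring.
Qed.

Lemma graded_adj (a b : 'I_3 -> int) (M : 'M_3) : graded_mx a b M ->
  forall i j, in_degree (\sum_k b k - \sum_k a k - (b i - a j)) (\adj M i j).
Proof.
move=> Mab i j; rewrite !sum3 adj3E mxE.
have E (i1 j1 i2 j2 : 'I_3) k : b j1 - a i1 + (b j2 - a i2) = k ->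
  in_degree k (M i1 j1 * M i2 j2) by move=> <-; apply: in_degreeM.
by elim/ord3_ind: i; elim/ord3_ind: j; apply: in_degreeB; apply: E => /=; ring.
Qed.

Lemma graded_det (a b : 'I_3 -> int) (M : 'M_3) : graded_mx a b M ->
  in_degree (\sum_i b i - \sum_i a i) (\det M).
Proof.
move=> Mab; rewrite det3E; have adjab := graded_adj Mab.
have E k : in_degree (\sum_i b i - \sum_i a i) (M o0 k * \adj M k o0).
  have -> : \sum_i b i - \sum_i a i =
    b k - a o0 + (\sum_i b i - \sum_i a i - (b k - a o0)) by ring.
  exact: in_degreeM.
by do ![apply: in_degreeD].
Qed.

Lemma graded_skew (a b : 'I_3 -> int) (v : 'rV_3) :
  (forall i j k, uniq [:: i; j; k] -> in_degree (b j - a i) (v 0 k)) ->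
  graded_mx a b (skew3 v).
Proof.
move=> H i j; rewrite mxE; elim/ord3_ind: i; elim/ord3_ind: j => /=;
  rewrite ?in_degree0 //; try apply: in_degreeN; exact: H.
Qed.

Lemma in_twisted_degreeP (a : seq int) k (v : 'rV[S]_(size a)) :
  reflect (forall j : 'I_(size a), in_degree (k + a`_j) (v 0 j))
    (in_twisted_degree k v).
Proof. exact: forallP. Qed.

Lemma in_twisted_degreeM (a b : seq int) k (v : 'rV[S]_(size a))
    (M : 'M_(size a, size b)) :
  graded_mx (fun i : 'I_(size a) => a`_i) (fun j : 'I_(size b) => b`_j) M ->
  in_twisted_degree k v -> in_twisted_degree k (v *m M).
Proof.
move=> Mab /in_twisted_degreeP vk; apply/in_twisted_degreeP => j.
rewrite mxE; apply: in_degree_sum => i.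
have -> : k + b`_j = k + a`_i + (b`_j - a`_i) by ring.
exact: in_degreeM.
Qed.

Lemma graded_differential (a b : seq int) (M : 'M_(size a, size b)) :
  (forall k (v : 'rV[S]_(size a)),
     in_twisted_degree k v -> in_twisted_degree k (v *m M)) ->
  graded_mx (fun i : 'I_(size a) => a`_i) (fun j : 'I_(size b) => b`_j) M.
Proof.
(* The basis vector [i] has degree [- a_i] in the twisted module. *)
move=> H i j; have /H/in_twisted_degreeP/(_ j) :
    in_twisted_degree (- a`_i) (delta_mx 0 i : 'rV[S]_(size a)).
  apply/in_twisted_degreeP => l; rewrite mxE /=.
  have [->|_] := eqVneq l i; last exact: in_degree0.
  by rewrite addNr -mpolyC1 in_degreeC.
by rewrite -rowE mxE addrC.
Qed.
End Grading.

(** * The saturation of the Jacobian ideal *)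

Section PowerSaturation.
Variable K : fieldType.
Local Notation S := {mpoly K[3]}.

Definition order_ge (n : nat) (p : S) := forall m, (mdeg m < n)%N -> p@_m = 0.

Lemma order_geM a b p q :
  order_ge a p -> order_ge b q -> order_ge (a + b) (p * q).
Proof.
move=> pa qb m mab; rewrite mcoeffM big1 // => -[k l] /= /eqP mE.
have [ka|ak] := ltnP (mdeg k) a; first by rewrite pa ?mul0r.
rewrite (qb l) ?mulr0 //; have := congr1 mdeg mE; rewrite mdegD.
by move=> mklE; lia.
Qed.

Lemma order_ge_prod n (u : 'I_n -> S) :
  (forall i, irrelevant (u i)) -> order_ge n (\prod_i u i).
Proof.
elim: n u => [|n IHn] u um; first by [].
rewrite big_ord_recl; apply: (@order_geM 1 n); last by apply: IHn.
move=> m; rewrite ltnS leqn0 mdeg_eq0 => /eqP->.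
by apply/irrelevantP.
Qed.

(** A product of [3N] elements without constant term has only monomials of degree at least [3N]; one
    exponent then reaches [N], so the product lies in the ideal of the [N]-th powers. *)
Lemma saturation_power (I : submodule S^o) (p : S) :
  in_saturation I p <-> exists N, forall i, I ('X_i ^+ N * p).
Proof.
split=> [[n nI]|[N NI]].
  exists n => i; have := nI (fun=> 'X_i); rewrite prodr_const card_ord.
  by apply=> _; apply/irrelevantP; rewrite mcoeffX mnm1_eq0.
exists (N + N + N)%N => u um.
have [m mN|q qE] := @mem_ideal_Xn K N (\prod_i u i).
  apply: (order_ge_prod um); rewrite mdegE sum3.
  by have := mN o0; have := mN o1; have := mN o2; lia.
have -> : (\prod_i u i) * p = \sum_i q i * ('X_i ^+ N * p).
  by rewrite qE mulr_suml; apply: eq_bigr => i _; rewrite mulrA.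
elim/big_ind: _ => [|x y|i _]; [exact: in_submodule0 | exact: in_submoduleD |].
exact: in_submoduleZ.
Qed.
End PowerSaturation.

Lemma unit_natC (n : nat) (K : numFieldType) (k : nat) :
  k.+1%:R \is a @GRing.unit {mpoly K[n]}.
Proof.
apply/unitrP; exists (k.+1%:R^-1)%:MP.
by rewrite -mpolyC_nat -!mpolyCM mulVf ?mulfV ?pnatr_eq0 // mpolyC1.
Qed.

Section JacobianModule.
Variables (K : numFieldType) (f : {mpoly K[3]}).
Local Notation S := {mpoly K[3]}.
Variables (A B : 'M[S]_3) (g h : 'rV[S]_3).
Hypotheses (syzA : exact_mx A g^T) (kerA : exact_mx h A) (h0 : h != 0).
Hypothesis depth2 : exact_mx g (skew3 g).
Hypotheses (gB : skew3 g = B *m A) (adjA : \adj A = g^T *m h).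
Hypotheses (h_irrelevant : forall i, irrelevant (h 0 i))
  (h_homog : forall i, exists d, h 0 i \is d.-homog).
Hypothesis jacobianE :
  forall p, in_jacobian f p <-> exists c : 'rV_3, p%:M = c *m g^T.
Local Notation w := (\det B).
Local Notation I := (saturation (jacobian_ideal f)).

Let g0 : g != 0. Proof. exact: depth2_neq0. Qed.

Let two_unit : 2 \is a @GRing.unit S. Proof. exact: unit_natC. Qed.

Lemma kernel_proper : ~ exists u : 'rV_3, 1%:M = u *m h^T.
Proof.
case=> u /matrixP/(_ 0 0); rewrite !mxE eqxx => /(congr1 (mcoeff 0)).
rewrite mcoeff1 eqxx raddf_sum big1 /= => [/eqP|i _]; first by rewrite oner_eq0.
apply/irrelevantP; rewrite mxE; have [a ->] := h_irrelevant i.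
exists (fun j => u 0 i * a j); rewrite mulr_sumr.
by apply: eq_bigr => j _; rewrite mulrA.
Qed.

Lemma kernel_powers : exists N T, \row_i 'X_i ^+ N = h *m T.
Proof.
have H i := kernel_primary i syzA kerA h0 h_homog.
have /fin_all_exists[N /fin_all_exists[u uP]] := H.
pose M := (\sum_i N i)%N.
have NM i : (N i <= M)%N by rewrite /M (bigD1 i) //= leq_addr.
exists M, (\matrix_(j, i) ('X_i ^+ (M - N i) * u i 0 j)); apply/rowP => i.
rewrite !mxE -{1}(subnK (NM i)) exprD.
have := congr1 (fun D : 'M_1 => D 0 0) (uP i).
rewrite !mxE eqxx mulr1n => ->; rewrite mulr_sumr; apply: eq_bigr => j _.
by rewrite !mxE; ring.
Qed.

Lemma kernel_koszul : koszul_exact h.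
Proof.
have [N [T NT]] := kernel_powers.
exact: koszul_exact_kernel kerA h0 _ _ (koszul_exact_Xn K N) NT.
Qed.

Lemma socle_colon s :
  in_jacobian f (s * w) <-> exists u : 'rV_3, s%:M = u *m h^T.
Proof.
rewrite jacobianE; split=> [[c]|[u su]]; first exact: colon_det.
exists (u *m B^T); rewrite mulrC scalar_mxM su mul_scalar_mx -mulmxA -trmx_mul.
by rewrite -(transition_det g0 gB adjA) [(_ *: h)^T]linearZ /= scalemxAr.
Qed.

Lemma socle_notin_jacobian : ~ in_jacobian f w.
Proof. by rewrite -[w]mul1r socle_colon; apply: kernel_proper. Qed.

Lemma saturation_socle p :
  I p <-> exists s, in_jacobian f (p - s * w).
Proof.
split=> [/saturation_power[N Np]|[s ps]].
  have [C CE] : exists C, (\row_i 'X_i ^+ N)^T *m p%:M = C *m g^T.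
    apply: mulmx_exists => i; have /jacobianE[c cE] := Np i; exists c.
    by rewrite -cE; apply/rowP => j; rewrite !ord1 !mxE big_ord1 !mxE.
  have [C' C'E] := kernel_annihilates syzA kerA (koszul_exact_Xn K N) CE.
  have [s [c sc]] := socle_generated syzA kerA g0 gB adjA two_unit
    kernel_proper kernel_koszul C'E.
  by exists s; apply/jacobianE; exists c.
(* [(h)] contains these powers and multiplies [w] into the Jacobian ideal. *)
have [N [T NT]] := kernel_powers; apply/saturation_power; exists N => i.
have -> : 'X_i ^+ N * p = 'X_i ^+ N * (p - s * w) + s * ('X_i ^+ N * w) by ring.
apply: (in_submoduleD (W := jacobian_ideal f)).
  exact: (in_submoduleZ (W := jacobian_ideal f)).
apply: (in_submoduleZ (W := jacobian_ideal f)).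
apply/socle_colon; exists (col i T)^T; apply/matrixP => a b; rewrite !ord1.
have := congr1 (fun D : 'rV_3 => D 0 i) NT.
rewrite !mxE eqxx mulr1n => ->; apply: eq_bigr => j _; rewrite !mxE mulrC //.
Qed.
End JacobianModule.

(** * Resolutions *)

Section Resolutions.
Variable K : fieldType.
Local Notation S := {mpoly K[3]}.

Definition cyclic_map (V : lmodType S) (x : V) (v : 'rV[S]_1) : V := v 0 0 *: x.

Lemma cyclic_map_is_linear (V : lmodType S) (x : V) : linear (cyclic_map x).
Proof. by move=> a u v; rewrite /cyclic_map !mxE scalerDl scalerA. Qed.

HB.instance Definition _ (V : lmodType S) (x : V) :=
  GRing.isLinear.Build S 'rV[S]_1 V _ (cyclic_map x) (cyclic_map_is_linear x).

Lemma rV_size0 (k m : nat) (u v : 'M[S]_(k, m)) : m = 0%N -> u = v.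
Proof. by move=> m0; apply/matrixP => i [j jm]; exfalso; rewrite m0 in jm. Qed.

Section Length3.
Variables t0 t1 t2 t3 : seq int.
Variables (D0 : 'M[S]_(size t1, size t0)) (D1 : 'M[S]_(size t2, size t1))
  (D2 : 'M[S]_(size t3, size t2)).
Local Notation t := [:: t0; t1; t2; t3].

Definition differential3 (i : nat) : 'M[S]_(rk t i.+1, rk t i) :=
  match i with 0 => D0 | 1 => D1 | 2 => D2 | _ => 0 end.

Definition sequence3 (V : lmodType S) (aug : {linear 'rV[S]_(size t0) -> V}) :
  free_sequence t V := @FreeSequence K t V aug differential3.

Lemma graded_resolution3 (V : lmodType S) (Vdeg : int -> V -> Prop)
    (W : V -> Prop) (aug : {linear 'rV[S]_(size t0) -> V}) :
  (forall k v, in_twisted_degree k v -> Vdeg k (aug v)) ->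
  graded_mx (fun i : 'I_(size t1) => t1`_i) (fun j : 'I_(size t0) => t0`_j) D0 ->
  graded_mx (fun i : 'I_(size t2) => t2`_i) (fun j : 'I_(size t1) => t1`_j) D1 ->
  graded_mx (fun i : 'I_(size t3) => t3`_i) (fun j : 'I_(size t2) => t2`_j) D2 ->
  (forall x, W x <-> exists v, x = aug v) ->
  (forall v, aug v = 0 <-> exists u, v = u *m D0) ->
  exact_mx D1 D0 -> exact_mx D2 D1 ->
  (forall v : 'rV_(size t3), v *m D2 = 0 -> v = 0) ->
  graded_resolution Vdeg W (sequence3 aug).
Proof.
move=> augdeg gD0 gD1 gD2 augW augK ex1 ex2 ex3.
have rk0 i : rk t i.+4 = 0%N by rewrite /rk nth_default.
split=> //.
- case=> [|[|[|i]]] k v; try exact: in_twisted_degreeM.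
  by move=> _; apply/in_twisted_degreeP => j; rewrite mulmx0 mxE in_degree0.
- case=> [|[|[|i]]] v; [exact: ex1 | exact: ex2 | |].
    split=> [/ex3->|[u ->]]; first by exists 0; rewrite mul0mx.
    by rewrite [u *m _]mulmx0 mul0mx.
  split=> _; last exact: mulmx0.
  by exists 0; apply: rV_size0; apply: rk0.
Qed.
End Length3.

Section Length2.
Variables t0 t1 t2 : seq int.
Variables (D0 : 'M[S]_(size t1, size t0)) (D1 : 'M[S]_(size t2, size t1)).
Local Notation t := [:: t0; t1; t2].

Definition differential2 (i : nat) : 'M[S]_(rk t i.+1, rk t i) :=
  match i with 0 => D0 | 1 => D1 | _ => 0 end.

Definition sequence2 (V : lmodType S) (aug : {linear 'rV[S]_(size t0) -> V}) :
  free_sequence t V := @FreeSequence K t V aug differential2.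

Lemma graded_resolution2 (V : lmodType S) (Vdeg : int -> V -> Prop)
    (W : V -> Prop) (aug : {linear 'rV[S]_(size t0) -> V}) :
  (forall k v, in_twisted_degree k v -> Vdeg k (aug v)) ->
  graded_mx (fun i : 'I_(size t1) => t1`_i) (fun j : 'I_(size t0) => t0`_j) D0 ->
  graded_mx (fun i : 'I_(size t2) => t2`_i) (fun j : 'I_(size t1) => t1`_j) D1 ->
  (forall x, W x <-> exists v, x = aug v) ->
  (forall v, aug v = 0 <-> exists u, v = u *m D0) ->
  exact_mx D1 D0 -> (forall v : 'rV_(size t2), v *m D1 = 0 -> v = 0) ->
  graded_resolution Vdeg W (sequence2 aug).
Proof.
move=> augdeg gD0 gD1 augW augK ex1 ex2.
have rk0 i : rk t i.+3 = 0%N by rewrite /rk nth_default.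
split=> //.
- case=> [|[|i]] k v; try exact: in_twisted_degreeM.
  by move=> _; apply/in_twisted_degreeP => j; rewrite mulmx0 mxE in_degree0.
- case=> [|[|i]] v; [exact: ex1 | |].
    split=> [/ex2->|[u ->]]; first by exists 0; rewrite mul0mx.
    by rewrite [u *m _]mulmx0 mul0mx.
  split=> _; last exact: mulmx0.
  by exists 0; apply: rV_size0; apply: rk0.
Qed.
End Length2.
End Resolutions.

Lemma irrelevant_skew (K : fieldType) (a : 'rV[{mpoly K[3]}]_3) :
  (forall i, irrelevant (a 0 i)) -> forall p q, irrelevant (skew3 a p q).
Proof.
move=> am p q; have E i : (a 0 i)@_0 = 0 by apply/irrelevantP.
apply/irrelevantP; rewrite mxE; elim/ord3_ind: p; elim/ord3_ind: q => /=;
  by rewrite ?mcoeffN ?E ?oppr0 ?mcoeff0.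
Qed.

(** * Resolutions of [N(f)] and [S/I_f], and the value of sigma *)

Section JacobianResolutions.
Variables (K : numFieldType) (f : {mpoly K[3]}) (d d1 d2 d3 : nat).
Local Notation S := {mpoly K[3]}.
Local Notation e := (d1%:Z + d2%:Z + d3%:Z).
Local Notation F1 := [:: 1 - d%:Z; 1 - d%:Z; 1 - d%:Z].
Local Notation F2 :=
  [:: 1 - d%:Z - d1%:Z; 1 - d%:Z - d2%:Z; 1 - d%:Z - d3%:Z].
Local Notation G1 := [:: d1%:Z + 2 - 2 * d%:Z; d2%:Z + 2 - 2 * d%:Z;
  d3%:Z + 2 - 2 * d%:Z].
Local Notation tM := [:: [:: 0 : int]; F1; F2; [:: - e]].
Local Notation tN := [:: [:: e + 3 - 3 * d%:Z]; G1; F2; [:: - e]].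
Local Notation tI := [:: [:: 0 : int];
  [:: 1 - d%:Z; 1 - d%:Z; 1 - d%:Z; e + 3 - 3 * d%:Z]; G1].
Local Notation degs t := (fun i : 'I_(size t) => t`_i : int).
Local Notation M := (milnor_algebra f).
Local Notation Mdeg := (quot_degree (jacobian_ideal f)).
Local Notation I := (saturation (jacobian_ideal f)).

Variables (A : 'M[S]_3) (g h : 'rV[S]_3).
Hypotheses (syzA : exact_mx A g^T) (kerA : exact_mx h A) (h0 : h != 0).
Hypothesis depth2 : exact_mx g (skew3 g).
Hypothesis adjA : \adj A = g^T *m h.
Hypothesis h_irrelevant : forall i, irrelevant (h 0 i).
Hypothesis jacobianE :
  forall p, in_jacobian f p <-> exists c : 'rV_3, p%:M = c *m g^T.
Hypotheses (g_graded : graded_mx (degs F1) (degs [:: 0 : int]) g^T)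
  (A_graded : graded_mx (degs F2) (degs F1) A)
  (h_graded : graded_mx (degs [:: - e]) (degs F2) h).

(** The Koszul relations of [g] have degree [2 * (d - 1)], whence the constant twist of the rows of
    [B]. *)
Lemma transition_graded : exists2 B,
  graded_mx (fun=> 2 - 2 * d%:Z) (degs F2) B & skew3 g = B *m A.
Proof.
have [B gB] : exists B, skew3 g = B *m A.
  by apply: exact_mx_factor syzA _; apply: skewK.
apply: graded_mx_factor A_graded gB; apply: graded_skew => i j k _.
have := g_graded k 0; rewrite mxE; congr (in_degree _ _).
by elim/ord3_ind: k; elim/ord3_ind: j => /=; ring.
Qed.

Lemma kernel_homog i : exists n, h 0 i \is n.-homog.
Proof.
have := h_graded 0 i; case: (_ - _) => n /=; first by exists n.
by move=> /eqP->; exists 0%N; apply: dhomog0.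
Qed.

Section Transition.
Variable B : 'M[S]_3.
Hypotheses (B_graded : graded_mx (fun=> 2 - 2 * d%:Z) (degs F2) B)
  (gB : skew3 g = B *m A).
Local Notation w := (\det B).
Local Notation sigma := (3 * (d%:Z - 1) - e).

Let hK : koszul_exact h := kernel_koszul syzA kerA h0 kernel_homog.
Let colonP := socle_colon syzA kerA depth2 gB adjA jacobianE.
Let satP := saturation_socle syzA kerA h0 depth2 gB adjA h_irrelevant
  kernel_homog jacobianE.
Let AE : A = skew3 h *m B^T.
Proof.
apply: (syzygies_koszul syzA kerA (depth2_neq0 depth2) gB adjA).
  exact: unit_natC.
exact: kernel_proper.
Qed.

Lemma det_graded : in_degree sigma w.
Proof.
have := graded_det B_graded; rewrite !sum3 /=; congr (in_degree _ _); ring.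
Qed.

Lemma koszul_graded : graded_mx (degs F2) (degs G1) (skew3 h).
Proof.
apply: graded_skew => i j k; have := h_graded 0 k.
elim/ord3_ind: i; elim/ord3_ind: j; elim/ord3_ind: k => //= hk _;
  by move: hk; congr (in_degree _ _); ring.
Qed.

Lemma kernel_tr_graded (s : int) : s = e + 3 - 3 * d%:Z ->
  graded_mx (degs G1) (degs [:: s]) h^T.
Proof.
move=> -> i j; rewrite mxE ord1; have := h_graded 0 i.
by elim/ord3_ind: i; congr (in_degree _ _) => /=; ring.
Qed.

(** The leftmost map of the Koszul complex of [h] is [h] itself, so it agrees by construction with
    that of the resolution of [M(f)]. *)
Lemma jacobian_module_resolution : exists rN : free_sequence tN M,
  minimal_graded_resolution Mdeg (jacobian_module f) rN /\
  differential rN 2 = h.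
Proof.
pose x : M := quot_proj (jacobian_ideal f) w.
exists (@sequence3 K [:: e + 3 - 3 * d%:Z] G1 F2 [:: - e] h^T (skew3 h) h M
  (cyclic_map x)); split=> //.
have xE (v : 'rV[S]_1) : cyclic_map x v = quot_proj (jacobian_ideal f) (v 0 0 * w).
  by rewrite /cyclic_map -linearZ.
split; last first.
  case=> [|[|[|i]]] p q.
  - by rewrite /= mxE ord1; apply: h_irrelevant.
  - exact: irrelevant_skew.
  - by rewrite /= ord1; apply: h_irrelevant.
  - by rewrite /= mxE; apply/irrelevantP; rewrite mcoeff0.
apply: graded_resolution3.
- move=> k v /in_twisted_degreeP/(_ 0) /= vk; rewrite xE; exists (v 0 0 * w) => //.
  by have := in_degreeM vk det_graded; congr (in_degree _ _); ring.
- exact: kernel_tr_graded.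
- exact: koszul_graded.
- exact: h_graded.
- move=> y; split=> [[p /satP[s ps] ->]|[v ->]].
    by exists s%:M; rewrite /= xE mxE eqxx mulr1n; apply/quot_proj_eq.
  rewrite /= xE; exists (v 0 0 * w) => //; apply/satP; exists (v 0 0).
  by rewrite subrr; apply: (in_submodule0 (jacobian_ideal f)).
- move=> v; rewrite /= xE {2}[v]mx11_scalar -colonP.
  by rewrite -(raddf0 (quot_proj (jacobian_ideal f))) quot_proj_eq subr0.
- by case: hK.
- by case: hK.
- by move=> v vh; apply: (mulmx_row_inj h0); rewrite mul0mx.
Qed.

Lemma jacobian_component k p : in_jacobian f p -> in_jacobian f (component k p).
Proof.
move=> /jacobianE[c pc]; apply/jacobianE.
exists (\row_i component (k - (d%:Z - 1)) (c 0 i)); apply/matrixP => a b.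
move/matrixP/(_ 0 0): pc; rewrite !ord1 !mxE eqxx !mulr1n => ->.
rewrite linear_sum; apply: eq_bigr => i _; rewrite !mxE.
have gd : in_degree (d%:Z - 1) (g 0 i).
  have := g_graded i 0; rewrite mxE; congr (in_degree _ _).
  by elim/ord3_ind: i => /=; ring.
by rewrite -(componentM _ _ gd); congr (component _ _); ring.
Qed.

(** As the Jacobian ideal is graded, the multiplier of [w] can be replaced by its component of
    degree [k - sigma]. *)
Lemma jacobian_module_degree k (y : M) : jacobian_module f y -> Mdeg k y ->
  exists2 a, in_degree (k - sigma) a & y = a *: quot_proj (jacobian_ideal f) w.
Proof.
move=> [p /satP[s ps] ->] [q qk /quot_proj_eq pq].
exists (component (k - sigma) s); first exact: in_degree_component.
rewrite -linearZ; transitivity (quot_proj (jacobian_ideal f) q).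
  exact/quot_proj_eq.
apply/quot_proj_eq; have qs : in_jacobian f (q - s * w).
  have -> : q - s * w = (p - s * w) - (p - q) by ring.
  rewrite -[- (p - q)]mulN1r.
  apply: (in_submoduleD (W := jacobian_ideal f)) => //.
  exact: (in_submoduleZ (W := jacobian_ideal f)).
have := jacobian_component k qs; rewrite linearB /= (component_in_degree _ qk) eqxx.
have -> : component k (s * w) = component (k - sigma) s * w; last by [].
by rewrite -(componentM _ _ det_graded); congr (component _ _); ring.
Qed.

(** Multipliers of [w] are constants in degree [sigma] and vanish below it. *)
Lemma jacobian_sigma : is_sigma f sigma.
Proof.
pose x : M := quot_proj (jacobian_ideal f) w.
have x0 : x <> 0.
  rewrite -(raddf0 (quot_proj (jacobian_ideal f))) /x => /quot_proj_eq.
  by rewrite subr0; apply: socle_notin_jacobian h_irrelevant _ => //; apply: gB.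
have xN : jacobian_module f x.
  exists w => //; apply/satP; exists 1; rewrite mul1r subrr.
  exact: (in_submodule0 (jacobian_ideal f)).
have xS : Mdeg sigma x by exists w => //; apply: det_graded.
split.
  pose W (v : M) := jacobian_module f v /\ Mdeg sigma v.
  have W1 : is_dim W 1.
    exists (fun=> x); split=> // v [vN vs].
    have [a a0 vE] := jacobian_module_degree vN vs; rewrite subrr in a0.
    have aE := in_degree0_const a0; exists (a@_0)%:M; split.
      by rewrite big_ord1 mxE eqxx mulr1n -aE.
    move=> c; rewrite big_ord1 vE => /eqP; rewrite -subr_eq0 -scalerBl aE -mpolyCB.
    have [ac _|ac /eqP cx] := eqVneq (a@_0) (c 0 0).
      by rewrite mpolyCK ac [RHS]mx11_scalar.
    have ac1 : (a@_0 - c 0 0)^-1 * (a@_0 - c 0 0) = 1 by rewrite mulVf ?subr_eq0.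
    case: x0; have := congr1 (fun y : M => (a@_0 - c 0 0)^-1%:MP *: y) cx.
    by rewrite scalerA -mpolyCM ac1 mpolyC1 scale1r scaler0.
  (* The dimension chosen by [xget] is not 0, as this would force [x = 0]. *)
  have := xgetPex 0%N (ex_intro (fun n => [set n | is_dim W n]%classic n) 1%N W1).
  rewrite /defect /Kdim -/W => Wd; apply/eqP => d0; rewrite d0 in Wd.
  case: Wd => b [_ /(_ x (conj xN xS))[c [xE _]]].
  by apply: x0; rewrite xE big_ord0.
move=> j; apply: contraR => jsig; apply/eqP.
rewrite /defect /Kdim; set P := [set n | _]%classic.
(* [Kdim] may select any admissible [n], so all are shown to be 0: on the zero space a nonempty
   family has no unique coordinates. *)
have Pn n : P n -> n = 0%N.
  case: n => [//|n] [b [Wb bP]].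
  have W0 v : jacobian_module f v /\ Mdeg j v -> v = 0.
    case=> vN vj; have [a aj ->] := jacobian_module_degree vN vj.
    have : in_degree (j - sigma) a := aj; case E : (j - sigma) => [m|m] /=.
      by move: E jsig; lia.
    by move=> /eqP->; rewrite scale0r.
  have [c [_ cu]] := bP _ (Wb ord0).
  have b0 i : b i = 0 by apply: W0.
  have bE (u : 'rV[K]_n.+1) : b ord0 = \sum_i (u 0 i)%:MP *: b i.
    by rewrite b0 big1 => [|i _]; [|rewrite b0 scaler0].
  have := etrans (esym (cu _ (bE (const_mx 0)))) (cu _ (bE (const_mx 1))).
  by move=> /rowP/(_ ord0)/eqP; rewrite !mxE eq_sym oner_eq0.
by case: xgetP => [n _ /Pn|].
Qed.

Lemma saturation_resolution : exists rI : free_sequence tI (quot_mod I),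
  graded_resolution (quot_degree I) (fun=> True) rI.
Proof.
pose T1 := [:: 1 - d%:Z; 1 - d%:Z; 1 - d%:Z; e + 3 - 3 * d%:Z].
pose D0 : 'M[S]_(3 + 1, 1) := col_mx g^T w%:M.
pose D1 : 'M[S]_(3, 3 + 1) := row_mx B^T (- h^T).
exists (@sequence2 K [:: 0] T1 G1 D0 D1 _ (cyclic_map (quot_proj I 1))).
have xE (v : 'rV[S]_1) : cyclic_map (quot_proj I 1) v = quot_proj I (v 0 0).
  by rewrite /cyclic_map -linearZ; congr (quot_proj I _); apply: mulr1.
have D10 : D1 *m D0 = 0.
  rewrite mul_row_col mulNmx mul_mx_scalar -trmx_mul.
  rewrite -(transition_det (depth2_neq0 depth2) gB adjA).
  by rewrite [(_ *: h)^T]linearZ /= subrr.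
have BTinj (v : 'rV_3) : v *m B^T = 0 -> v = 0.
  move=> /(congr1 (mulmxr (\adj B)^T)) /=; rewrite mul0mx -mulmxA -trmx_mul.
  rewrite mul_adj_mx tr_scalar_mx mul_mx_scalar => /eqP; rewrite scalemx_eq0.
  case/orP=> [/eqP w0|/eqP//].
  case: (socle_notin_jacobian syzA kerA depth2 gB adjA h_irrelevant jacobianE).
  by rewrite w0; apply: (in_submodule0 (jacobian_ideal f)).
apply: graded_resolution2.
- move=> k v /in_twisted_degreeP/(_ 0) /= vk; rewrite xE; exists (v 0 0) => //.
  by move: vk; rewrite addr0.
- suff H : forall (i : 'I_(3 + 1)) (j : 'I_1),
    in_degree ([:: 0]`_j - T1`_i) (D0 i j) by exact: H.
  move=> i j; rewrite ord1; case: (split_ordP i) => k ->.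
    rewrite col_mxEu; have := g_graded k 0; congr (in_degree _ _).
    by elim/ord3_ind: k.
  rewrite col_mxEd !ord1 mxE eqxx mulr1n; have := det_graded; congr (in_degree _ _).
  by rewrite /T1 /=; ring.
- suff H : forall (i : 'I_3) (j : 'I_(3 + 1)),
    in_degree (T1`_j - G1`_i) (D1 i j) by exact: H.
  move=> i j; case: (split_ordP j) => k ->.
    rewrite row_mxEl mxE; have := B_graded k i; congr (in_degree _ _).
    by elim/ord3_ind: k; elim/ord3_ind: i => /=; ring.
  rewrite row_mxEr ord1 mxE; apply: in_degreeN.
  by have := kernel_tr_graded (erefl _) i 0; congr (in_degree _ _).
- move=> y; split=> // _; exists (quot_repr y)%:M.
  by rewrite /= xE mxE eqxx mulr1n quot_reprK.
- move=> v; rewrite /= xE -(raddf0 (quot_proj I)) quot_proj_eq subr0 satP.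
  split=> [[s /jacobianE[c cE]]|[u ->]].
    suff vE : v = row_mx c s%:M *m D0 by exact: (ex_intro _ (row_mx c s%:M)).
    rewrite mul_row_col -cE -scalar_mxM -raddfD /= subrK.
    exact: mx11_scalar.
  exists (rsubmx (u : 'rV_(3 + 1)) 0 0); apply/jacobianE.
  exists (lsubmx (u : 'rV_(3 + 1))).
  have -> : u *m D0 = lsubmx (u : 'rV_(3 + 1)) *m g^T +
      rsubmx (u : 'rV_(3 + 1)) *m w%:M.
    by rewrite -mul_row_col hsubmxK.
  move: (lsubmx _) (rsubmx _) => c s.
  rewrite mul_mx_scalar mxE [(_ *: s) 0 0]mxE mulrC addrK.
  exact/esym/mx11_scalar.
- suff H : exact_mx D1 D0 by exact: H.
  move=> v; split=> [|[u ->]]; last by rewrite -mulmxA D10 mulmx0.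
  rewrite -[v]hsubmxK; move: (lsubmx v) (rsubmx v) => c s.
  rewrite mul_row_col => cs.
  have /colonP[u su] : in_jacobian f (s 0 0 * w).
    apply/jacobianE; exists (- c); rewrite mulNmx; apply/eqP; rewrite -addr_eq0.
    by rewrite scalar_mxM -mx11_scalar addrC cs.
  rewrite -mx11_scalar in su.
  have : (c + u *m B^T) *m g^T = 0.
    rewrite mulmxDl -mulmxA -trmx_mul -(transition_det (depth2_neq0 depth2) gB adjA).
    by rewrite [(_ *: h)^T]linearZ /= -scalemxAr -su -mul_mx_scalar.
  (* Adding multiples of the rows of [D1] has turned the relation into a syzygy of [g]; since
     [A = skew3 h *m B^T] and [skew3 h *m h^T = 0], that syzygy comes from the same rows. *)
  move=> /syzA[v1 cE]; exists (v1 *m skew3 h - u).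
  rewrite mul_mx_row !mulmxN !mulmxBl -!mulmxA skewK mulmx0 sub0r opprK -su.
  by rewrite -AE -cE addrK.
- suff H : forall v : 'rV_3, v *m D1 = 0 -> v = 0 by exact: H.
  move=> v; rewrite mul_mx_row => /(congr1 lsubmx); rewrite row_mxKl.
  by rewrite linear0; apply: BTinj.
Qed.

End Transition.

Lemma jacobian_resolutions :
  [/\ exists rN : free_sequence tN M,
        minimal_graded_resolution Mdeg (jacobian_module f) rN /\
        differential rN 2 = h,
      is_sigma f (3 * (d%:Z - 1) - e)
    & exists rI : free_sequence tI (quot_mod I),
        graded_resolution (quot_degree I) (fun=> True) rI].
Proof.
have [B B_graded gB] := transition_graded.
split; [exact: jacobian_module_resolution | exact: jacobian_sigma |].
exact: saturation_resolution.
Qed.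
End JacobianResolutions.

(** Depth grows with the ideal, and [(g)] lies in [(g')]: [U^T] sends a vector parallel to [g'] to
    one parallel to [g], with the same ratio. This carries depth two from the gradient to other
    generators. *)
Lemma depth2_transfer (S : idomainType) (g g' : 'rV[S]_3) (U : 'M[S]_3) :
  g^T = U *m g'^T -> exact_mx g (skew3 g) -> exact_mx g' (skew3 g').
Proof.
move=> gU depth2 c; split; last by case=> u ->; rewrite -mulmxA mul_skew mulmx0.
move=> /skew_eq0_tr cg'; have g0 := depth2_neq0 depth2.
have gU' : g = g' *m U^T by apply: trmx_inj; rewrite gU trmx_mul trmxK.
have [l cl] : exists l, c *m U^T = l *m g.
  apply/depth2/tr_eq_skew0; rewrite gU gU' trmx_mul trmxK !mulmxA; congr (_ *m _).
  by rewrite -!mulmxA cg'.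
exists l^T; apply: trmx_inj; apply: (mulmx_row_inj g0) => /=.
by rewrite trmx_mul trmxK -mulmxA -cl {1}gU' mulmxA cg' mulmxA.
Qed.

Lemma jacobian_grad (K : numFieldType) (f p : {mpoly K[3]}) :
  in_jacobian f p <-> exists c : 'rV_3, p%:M = c *m (grad f)^T.
Proof.
split=> [[a pE]|[c /matrixP/(_ 0 0)]].
  exists (\row_i a i); apply/matrixP => i j; rewrite !ord1 !mxE eqxx mulr1n pE.
  by apply: eq_bigr => l _; rewrite !mxE.
rewrite !mxE eqxx mulr1n => ->; exists (c 0).
by apply: eq_bigr => l _; rewrite !mxE.
Qed.

(** * Arbitrary minimal resolutions of [M(f)], and existence of one *)

Section Main.
Variables (K : numFieldType) (f : {mpoly K[3]}) (d d1 d2 d3 : nat).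
Hypotheses (d_gt1 : (1 < d)%N) (fd : f \is d.-homog) (f_reduced : reduced f).
Local Notation S := {mpoly K[3]}.
Local Notation e := (d1%:Z + d2%:Z + d3%:Z).
Local Notation F1 := [:: 1 - d%:Z; 1 - d%:Z; 1 - d%:Z].
Local Notation F2 :=
  [:: 1 - d%:Z - d1%:Z; 1 - d%:Z - d2%:Z; 1 - d%:Z - d3%:Z].
Local Notation G1 := [:: d1%:Z + 2 - 2 * d%:Z; d2%:Z + 2 - 2 * d%:Z;
  d3%:Z + 2 - 2 * d%:Z].
Local Notation tM := [:: [:: 0 : int]; F1; F2; [:: - e]].
Local Notation tN := [:: [:: e + 3 - 3 * d%:Z]; G1; F2; [:: - e]].
Local Notation tI := [:: [:: 0 : int];
  [:: 1 - d%:Z; 1 - d%:Z; 1 - d%:Z; e + 3 - 3 * d%:Z]; G1].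
Local Notation degs t := (fun i : 'I_(size t) => t`_i : int).
Local Notation M := (milnor_algebra f).
Local Notation Mdeg := (quot_degree (jacobian_ideal f)).
Local Notation I := (saturation (jacobian_ideal f)).

Let grad_depth : exact_mx (grad f) (skew3 (grad f)).
Proof. by apply: grad_depth2 fd f_reduced; apply: ltnW. Qed.

Lemma grad_degree i : in_degree (d%:Z - 1) (f^`M(i)).
Proof.
have -> : d%:Z - 1 = d.-1 by lia.
apply/dhomogP => m; rewrite mcoeff_msupp mcoeff_mderiv mulrn_eq0 negb_or /=.
rewrite -mcoeff_msupp => /(dhomog_mf fd) fm.
have : mdeg (m + U_(i)) = d := fm; rewrite mdegD mdeg1 => <-.
by rewrite addn1.
Qed.

Lemma jacobian_irrelevant p : in_jacobian f p -> p@_0 = 0.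
Proof.
case=> a ->; rewrite raddf_sum big1 //= => i _.
rewrite (rmorphM (mcoeff 0)) /= (in_degree_coef0 (grad_degree i)) ?mulr0 //.
by apply/eqP; lia.
Qed.

Lemma mpoly_unit_const (l : S) : l \is a GRing.unit -> in_degree 0 l.
Proof. by move=> /andP[/eqP-> _]; apply: in_degreeC. Qed.

(** In an arbitrary resolution the augmentation sends 1 to the class of a nonzero constant, and the
    entries of the first differential still generate the Jacobian ideal. *)
Lemma minimal_resolution_consequences (rM : free_sequence tM M) :
  minimal_graded_resolution Mdeg (fun=> True) rM ->
  [/\ exists rN : free_sequence tN M,
        minimal_graded_resolution Mdeg (jacobian_module f) rN /\
        differential rN 2 = differential rM 2,
      is_sigma f (3 * (d%:Z - 1) - e)
    & exists rI : free_sequence tI (quot_mod I),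
        graded_resolution (quot_degree I) (fun=> True) rI].
Proof.
case=> [[augdeg difdeg augW augK ex] irr].
pose D0 : 'M[S]_(3, 1) := differential rM 0.
pose A : 'M[S]_3 := differential rM 1; pose h : 'rV[S]_3 := differential rM 2.
have syzA : exact_mx A D0 := ex 0%N.
have kerA : exact_mx h A := ex 1%N.
(* The next free module has rank 0, so [h] is injective. *)
have h0 : h != 0.
  apply/eqP => hE; have [+ _] := ex 2%N (1%:M : 'rV_1).
  rewrite -[differential rM 2]/h hE mulmx0 => /(_ erefl)[u].
  have -> : u *m differential rM 3 = 0.
    by apply/matrixP => i j; rewrite !mxE big1 // => -[].
  by move=> /matrixP/(_ 0 0)/eqP; rewrite !mxE eqxx oner_eq0.
have [q q0 augq] : Mdeg 0 (aug rM (1%:M : 'rV_1)).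
  by apply/augdeg/in_twisted_degreeP => j; rewrite !ord1 mxE -mpolyC1 in_degreeC.
have augE (v : 'rV[S]_1) : aug rM v = quot_proj (jacobian_ideal f) (v 0 0 * q).
  by rewrite [v in LHS]mx11_scalar -scalemx1 linearZ /= augq -linearZ.
have qE := in_degree0_const q0; set c := q@_0 in qE.
have c0 : c != 0.
  have [v vE] := (augW (quot_proj (jacobian_ideal f) 1)).1 Logic.I.
  move: vE; rewrite augE => /quot_proj_eq/jacobian_irrelevant.
  rewrite mcoeffB mcoeff1 eqxx (rmorphM (mcoeff 0)) /= -/c => /eqP.
  by rewrite subr_eq0; apply: contraTneq => ->; rewrite mulr0 oner_eq0.
have jacD0 p : in_jacobian f p <-> exists u : 'rV_3, p%:M = u *m D0.
  rewrite -[exists u, _]/(exists u, p%:M = u *m differential rM 0) -augK augE.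
  rewrite mxE eqxx mulr1n -(raddf0 (quot_proj (jacobian_ideal f))) quot_proj_eq.
  rewrite subr0 qE mulrC; split=> [|pc].
    exact: (in_submoduleZ (W := jacobian_ideal f)).
  have -> : p = c^-1%:MP * (c%:MP * p) by rewrite mulrA -mpolyCM mulVf // mul1r.
  exact: (in_submoduleZ (W := jacobian_ideal f)).
have [U gU] : exists U, (grad f)^T = U *m D0.
  apply: mulmx_exists => i; have /jacD0[u uE] : in_jacobian f f^`M(i).
    apply/jacobian_grad; exists (delta_mx 0 i); apply/matrixP => a b.
    by rewrite -rowE !ord1 !mxE eqxx mulr1n.
  by exists u; rewrite -uE; apply/matrixP => a b; rewrite !ord1 !mxE eqxx mulr1n.
have depth0 : exact_mx D0^T (skew3 D0^T).
  by apply: depth2_transfer grad_depth; rewrite trmxK; exact: gU.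
have syz0 : exact_mx A D0^T^T by rewrite trmxK.
have [l [B [lU _ adjA]]] := left_kernel_normalize syz0 depth0 kerA.
have l0 : l != 0 by apply: contraTneq lU => ->; rewrite unitr0.
set g := l *: D0^T in adjA.
have gE : g^T = l *: D0 by rewrite /g linearZ /= trmxK.
apply: (jacobian_resolutions _ kerA h0 _ adjA).
- move=> v; rewrite gE -scalemxAr; split=> [/eqP|/syzA->]; last by rewrite scaler0.
  by rewrite scalemx_eq0 (negPf l0) => /eqP/syzA.
- apply: (depth2_transfer (U := (l^-1)%:M)) depth0.
  by rewrite gE trmxK mul_scalar_mx scalerA mulVr // scale1r.
- by move=> i; apply: (irr 2%N).
- move=> p; rewrite jacD0 gE; split=> [[u ->]|[u ->]].
    by exists (l^-1 *: u); rewrite -scalemxAl -scalemxAr scalerA mulVr // scale1r.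
  by exists (l *: u); rewrite -scalemxAr scalemxAl.
- move=> i j; rewrite gE mxE -[_ - _]add0r; apply: in_degreeM.
    exact: mpoly_unit_const.
  exact: (graded_differential (difdeg 0%N)).
- exact: (graded_differential (difdeg 1%N)).
- exact: (graded_differential (difdeg 2%N)).
Qed.

Lemma minimal_resolution_exists : syzygy_curve f [:: d1; d2; d3] ->
  exists rM : free_sequence tM M,
    minimal_graded_resolution Mdeg (fun=> True) rM.
Proof.
case=> _ [rho [rhoAR rho_deg rho_gen rho_min]].
pose A : 'M[S]_3 := \matrix_i (rho i : 'rV[S]_3).
have ARE (r : 'rV[S]_3) : AR f r <-> r *m (grad f)^T = 0.
  rewrite /AR; have -> : \sum_i r 0 i * f^`M(i) = (r *m (grad f)^T) 0 0.
    by rewrite mxE; apply: eq_bigr => i _; rewrite !mxE.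
  split=> [r0|->]; last by rewrite mxE.
  by apply/matrixP => i j; rewrite !ord1 r0 mxE.
have syzA : exact_mx A (grad f)^T.
  move=> v; split=> [/ARE/rho_gen[a ->]|[u ->]].
    exists (\row_i a i); rewrite mulmx_sum_row.
    by apply: eq_bigr => i _; rewrite rowK mxE.
  rewrite (mulmx_sum_row u) mulmx_suml big1 // => i _; rewrite -scalemxAl rowK.
  by rewrite ((ARE _).1 (rhoAR i)) scaler0.
have [B [h [gB adjA h0 kerA]]] := left_kernel syzA grad_depth.
have A_graded : graded_mx (degs F2) (degs F1) A.
  move=> i j; rewrite mxE; have : in_degree (nth 0%N [:: d1; d2; d3] i) (rho i 0 j).
    exact: rho_deg.
  by congr (in_degree _ _); elim/ord3_ind: i; elim/ord3_ind: j => /=; ring.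
have g_graded : graded_mx (degs F1) (degs [:: 0 : int]) (grad f)^T.
  move=> i j; rewrite !mxE ord1; have := grad_degree i; congr (in_degree _ _).
  by elim/ord3_ind: i => /=; ring.
(* The degrees of [h] are those of [\adj A = g^T *m h] after division by a nonzero partial
   derivative. *)
have h_graded : graded_mx (degs [:: - e]) (degs F2) h.
  move=> i j; rewrite ord1; have /rV0Pn[k gk] := depth2_neq0 grad_depth.
  apply: (in_degree_div (k := d%:Z - 1) gk).
    by rewrite mxE; apply: grad_degree.
  have := graded_adj A_graded k j; rewrite adjA mxE big_ord1 mxE mulrC.
  congr (in_degree _ _); rewrite !sum3 /=.
  by elim/ord3_ind: k {gk}; elim/ord3_ind: j => /=; ring.
(* A homogeneous entry with nonzero constant term is a constant, and [h *m A = 0] would then express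
   [rho i] through the other generators. *)
have h_irrelevant i : irrelevant (h 0 i).
  apply/irrelevantP/eqP/contraT => hi.
  have hi_deg := h_graded 0 i; set k := _ - _ in hi_deg.
  have k0 : k = 0 by apply/eqP; apply: contraNT hi => /(in_degree_coef0 hi_deg)->.
  rewrite k0 in hi_deg; have hE := in_degree0_const hi_deg.
  case: (rho_min i); exists (fun j => - ((h 0 i)@_0)^-1%:MP * h 0 j).
  have : h *m A = 0 by exact: exact_mxM.
  rewrite mulmx_sum_row (bigD1 i) //= rowK => /eqP; rewrite addr_eq0 => /eqP hA.
  have -> : rho i = ((h 0 i)@_0)^-1%:MP *: (h 0 i *: rho i).
    by rewrite scalerA [in X in _ * X]hE -mpolyCM mulVf // scale1r.
  rewrite hA scalerN scaler_sumr -sumrN; apply: eq_bigr => j _.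
  by rewrite rowK scalerA mulNr scaleNr.
have hhom := kernel_homog h_graded.
have AE : A = skew3 h *m B^T.
  apply: (syzygies_koszul syzA kerA (depth2_neq0 grad_depth) gB adjA).
    exact: unit_natC.
  exact: kernel_proper.
exists (@sequence3 K [:: 0] F1 F2 [:: - e] (grad f)^T A h M
  (cyclic_map (quot_proj (jacobian_ideal f) 1))).
have xE (v : 'rV[S]_1) : cyclic_map (quot_proj (jacobian_ideal f) 1) v =
    quot_proj (jacobian_ideal f) (v 0 0).
  by rewrite /cyclic_map -linearZ; congr (quot_proj _ _); apply: mulr1.
split; last first.
  case=> [|[|[|i]]] p q.
  - rewrite /= !mxE; apply/irrelevantP/(in_degree_coef0 (grad_degree p)).
    by apply/eqP; lia.
  (* The factor [skew3 h] puts every entry of [A] in the ideal of [h], hence in the irrelevant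
     ideal. *)
  - rewrite /= AE mxE; apply/irrelevantP; rewrite raddf_sum big1 //= => k _.
    rewrite (rmorphM (mcoeff 0)) /=.
    by have /irrelevantP-> := irrelevant_skew h_irrelevant p k; rewrite mul0r.
  - by rewrite /= ord1.
  - by rewrite /= mxE; apply/irrelevantP; rewrite mcoeff0.
apply: graded_resolution3 => //.
- move=> k v /in_twisted_degreeP/(_ 0) /= vk; rewrite xE; exists (v 0 0) => //.
  by move: vk; rewrite addr0.
- move=> y; split=> // _; exists (quot_repr y)%:M.
  by rewrite /= xE mxE eqxx mulr1n quot_reprK.
- move=> v; rewrite /= xE {2}[v]mx11_scalar -jacobian_grad.
  by rewrite -(raddf0 (quot_proj (jacobian_ideal f))) quot_proj_eq subr0.
- by move=> v vh; apply: (mulmx_row_inj h0); rewrite mul0mx.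
Qed.
End Main.

Theorem theorem3p9 (R : realType) (d d1 d2 d3 : nat)
    (f : {mpoly (complex R)[3]}) :
  (3 <= d)%N -> f \is d.-homog -> reduced f ->
  syzygy_curve f [:: d1; d2; d3] ->
  let e : int := d1%:Z + d2%:Z + d3%:Z in
  let tM : seq (seq int) :=
    [:: [:: 0];
        [:: 1 - d%:Z; 1 - d%:Z; 1 - d%:Z];
        [:: 1 - d%:Z - d1%:Z; 1 - d%:Z - d2%:Z; 1 - d%:Z - d3%:Z];
        [:: - e]] in
  let tN : seq (seq int) :=
    [:: [:: e + 3 - 3 * d%:Z];
        [:: d1%:Z + 2 - 2 * d%:Z; d2%:Z + 2 - 2 * d%:Z; d3%:Z + 2 - 2 * d%:Z];
        [:: 1 - d%:Z - d1%:Z; 1 - d%:Z - d2%:Z; 1 - d%:Z - d3%:Z];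
        [:: - e]] in
  let tI : seq (seq int) :=
    [:: [:: 0];
        [:: 1 - d%:Z; 1 - d%:Z; 1 - d%:Z; e + 3 - 3 * d%:Z];
        [:: d1%:Z + 2 - 2 * d%:Z; d2%:Z + 2 - 2 * d%:Z;
            d3%:Z + 2 - 2 * d%:Z]] in
  let M := milnor_algebra f in
  let Mdeg : int -> M -> Prop := quot_degree (jacobian_ideal f) in
  let I := saturation (jacobian_ideal f) in
  [/\ exists rM : free_sequence tM M,
        minimal_graded_resolution Mdeg (fun=> True) rM,
      forall rM : free_sequence tM M,
        minimal_graded_resolution Mdeg (fun=> True) rM ->
        exists rN : free_sequence tN M,
          minimal_graded_resolution Mdeg (jacobian_module f) rN /\
          differential rN 2 = differential rM 2,
      is_sigma f (3 * (d%:Z - 1) - (d1%:Z + d2%:Z + d3%:Z))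
    & (2 <= d1)%N ->
      exists rI : free_sequence tI (quot_mod I),
        graded_resolution (quot_degree I) (fun=> True) rI].
Proof.
move=> d_ge3 fd f_reduced curve e tM tN tI M Mdeg I.
have d_gt1 : (1 < d)%N by apply: ltnW.
have conseq := minimal_resolution_consequences d_gt1 fd f_reduced.
have [rM rM_min] := minimal_resolution_exists d_gt1 fd f_reduced curve.
have [_ sigmaP satP] := conseq _ _ _ rM rM_min.
split=> // [|rM' rM'_min]; first by exists rM.
by have [] := conseq _ _ _ rM' rM'_min.
Qed.
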